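(* Let $G$ be a graph with vertex set $[n]$ and $\sigma=(1\;2\;\cdots\;n)$. The set $\{x_T\}$, where $T$ ranges over all $G$-reduced noncrossing trees, is a basis of $\mathcal E_G^\sigma$. Consequently, all linear relations in $\mathcal E_G^\sigma$ among the elements $x_T$ ($T\subset G$ a noncrossing tree on $[n]$) are generated by the relations \[x_{T_m}=x_{T_1}-x_{T_2}-\cdots-x_{T_{m-1}},\] where $1\le i_1<\dots<i_m\le n$, $H\subset G$ is a connected noncrossing graph on $[n]$ whose unique cycle is $(i_1,\dots,i_m)$, $T_1=H\setminus\overline{i_1i_m}$ and $T_j=H\setminus\overline{i_{j-1}i_j}$ for $1<j\le m$; and repeatedly rewriting an element of $\mathcal E_G^\sigma$ by replacing some $x_{T_m}$ by the right-hand side of such a relation always terminates in the unique expansion of that element in this basis, independent of the choices made.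
   Context: The Fomin–Kirillov algebra $\mathcal E_n$ is the quadratic $\mathbf Q$-algebra with generators $x_{ij}=-x_{ji}$ for distinct $i,j\in[n]$, subject to: $x_{ij}^2=0$; $x_{ij}x_{kl}=x_{kl}x_{ij}$ for distinct $i,j,k,l$; $x_{ij}x_{jk}+x_{jk}x_{ki}+x_{ki}x_{ij}=0$ for distinct $i,j,k$. For a graph $G$ on $[n]$, $\mathcal E_G$ is the subalgebra generated by $x_{ij}$ for edges $\overline{ij}$ of $G$. For a monomial $P=x_{i_1j_1}\cdots x_{i_dj_d}$, $\sigma_P=(i_1\;j_1)\cdots(i_d\;j_d)$; $P$ is simple if $\sigma_P$ has exactly $n-d$ cycles. $\mathcal E_G^\sigma$ is the linear span in $\mathcal E_G$ of all simple monomials in the generators of $\mathcal E_G$ with $\sigma_P=\sigma$. A graph on $[n]$ is noncrossing if it has no two edges $\overline{ac},\overline{bd}$ with $a<b<c<d$. For a noncrossing tree $T$ on $[n]$ and vertex $i$, order the edges $\overline{ij}$ of $T$ at $i$ by the position of $j$ in the sequence $i-1,\dots,1,n,\dots,i+1$; $x_T$ is the product $x_{a_1b_1}\cdots x_{a_{n-1}b_{n-1}}$ ($a_k<b_k$) over the edges of $T$ in any order such that at every vertex the edges occur in this order (all such products are equal). A noncrossing tree $T$ on $[n]$ is $G$-reduced if $T\subset G$ and there do not exist $1\le i_1<i_2<\dots<i_m\le n$ such that $\overline{i_1i_m}\in T$, $\overline{i_{j-1}i_j}\in T$ for all $1<j<m$, $\overline{i_{m-1}i_m}\in G$, and $T\cup\overline{i_{m-1}i_m}$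 is noncrossing.
   Formalization: In the definition of G-reduced the sequences i_1<…<i_m are taken with m≥3 (with m=2 allowed, no tree having an edge would be G-reduced, and the claim fails already for n=2, G={12}); also n≥1 is assumed. *)

(* Defs.v *)
(* Fomin--Kirillov algebra, presented as the free
   Q-algebra on ordered pairs modulo the two-sided ideal of relations. *)
From HB Require Import structures.
From mathcomp Require Import all_boot all_order all_fingroup all_algebra.
From Stdlib Require Import Relations.
Set Implicit Arguments.
Unset Strict Implicit.
Unset Printing Implicit Defensive.
Import Order.TTheory GRing.Theory Num.Theory.
Local Open Scope ring_scope.

Section FK.
Variable n : nat.
(* Vertices [n] = {1..n} are represented by 'I_n = {0..n-1} (vertex k+1 <-> k). *)

Definition gen := {p : 'I_n * 'I_n | p.1 != p.2}.
Definition word := seq gen.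
(* elements of the free Q-algebra Q<x_ab> as formal finite sums *)
Definition fsum := seq (rat * word).

Definition coeff (f : fsum) (w : word) : rat := \sum_(p <- f | p.2 == w) p.1.
Definition scaleF (c : rat) (f : fsum) : fsum := [seq (c * p.1, p.2) | p <- f].
Definition mulF (f g : fsum) : fsum :=
  [seq (p.1 * q.1, p.2 ++ q.2) | p <- f, q <- g].
Definition monoF (w : word) : fsum := [:: (1, w)].

Definition is_rel (r : fsum) : Prop :=
  (exists g h : gen, val h = ((val g).2, (val g).1) /\
       r = [:: (1, [:: g]); (1, [:: h])])
  \/ (exists g : gen, r = [:: (1, [:: g; g])])
  \/ (exists g h : gen, uniq [:: (val g).1; (val g).2; (val h).1; (val h).2] /\
       r = [:: (1, [:: g; h]); (-1, [:: h; g])])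
  \/ (exists g1 g2 g3 : gen,
       (val g1).2 = (val g2).1 /\ (val g2).2 = (val g3).1 /\ (val g3).2 = (val g1).1 /\
       uniq [:: (val g1).1; (val g2).1; (val g3).1] /\
       r = [:: (1, [:: g1; g2]); (1, [:: g2; g3]); (1, [:: g3; g1])]).

Definition inI (f : fsum) : Prop :=
  exists s : seq ((rat * word) * fsum * word),
    (forall t, t \in s -> is_rel t.1.2) /\
    forall w, coeff f w =
      coeff (flatten [seq mulF (mulF [:: t.1.1] t.1.2) (monoF t.2) | t <- s]) w.

Definition congr (f g : fsum) : Prop := inI (f ++ scaleF (-1) g).

Definition edge := {e : 'I_n * 'I_n | (e.1 < e.2)%N}.
Definition graph := {set edge}.

Definition eset (a b : 'I_n) : {set edge} :=
  [set e : edge | (val e == (a, b)) || (val e == (b, a))].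

Definition adj (H : graph) : rel 'I_n :=
  fun a b => [exists e in H, (val e == (a, b)) || (val e == (b, a))].

Definition connected (H : graph) : bool := [forall a, forall b, connect (adj H) a b].
Definition is_tree (T : graph) : bool := connected T && (#|T| == n.-1).

Definition noncrossing (H : graph) : bool :=
  [forall e in H, forall f in H,
     ~~ [&& ((val e).1 < (val f).1)%N, ((val f).1 < (val e).2)%N & ((val e).2 < (val f).2)%N]].

Definition nctree (T : graph) : bool := is_tree T && noncrossing T.

Lemma edge_neq (e : edge) : (val e).1 != (val e).2.
Proof. by case: e => [[a b]] /= hab; rewrite -val_eqE /= neq_ltn hab. Qed.
Definition gen_of_edge (e : edge) : gen := exist _ (val e) (edge_neq e).

(* position of j in the sequence i-1, ..., 1, n, ..., i+1 (indices mod n) *)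
Definition rank (i j : 'I_n) : nat := ((i + n - j) %% n)%N.
Definition other (e : edge) (i : 'I_n) : 'I_n :=
  if (val e).1 == i then (val e).2 else (val e).1.
Definition incident (e : edge) (i : 'I_n) : bool := ((val e).1 == i) || ((val e).2 == i).

Definition valid_order (T : graph) (s : seq edge) : bool :=
  perm_eq s (enum T) &&
  [forall e in T, forall f in T, forall i : 'I_n,
     [&& incident e i, incident f i & (rank i (other e i) < rank i (other f i))%N]
       ==> (index e s < index f s)%N].

Definition xword (T : graph) : seq edge :=
  head [::] [seq s <- permutations (enum T) | valid_order T s].
Definition xT (T : graph) : fsum := monoF (map gen_of_edge (xword T)).

(* sigma_P = (i1 j1) o (i2 j2) o ... o (id jd) (composition of functions);
   in MathComp, (s * t) x = t (s x). *)
Definition sigmaP (w : word) : {perm 'I_n} :=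
  foldr (fun g s => (s * tperm (val g).1 (val g).2)%g) 1%g w.
Definition sigma_long : {perm 'I_n} := perm (@ordS_inj n).

Definition simple (w : word) : bool := #|porbits (sigmaP w)| == (n - size w)%N.

Definition in_graph (G : graph) (g : gen) : bool :=
  [exists e in G, (val e == val g) || (val e == ((val g).2, (val g).1))].

Definition simple_mono (G : graph) (s : {perm 'I_n}) (w : word) : bool :=
  all (in_graph G) w && simple w && (sigmaP w == s).

Definition inEGs (G : graph) (s : {perm 'I_n}) (f : fsum) : Prop :=
  exists g : fsum, (forall p, p \in g -> simple_mono G s p.2) /\ congr f g.

Definition has_edge (H : graph) (a b : 'I_n) : bool := eset a b :&: H != set0.

(* T is G-reduced.  The sequence i_1 < ... < i_m is the list a :: c (m = size c + 1);
   m >= 3 is required (for m = 2 the condition would hold for every edge of T). *)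
Definition G_reduced (G : graph) (T : graph) : Prop :=
  [/\ nctree T, T \subset G &
  ~ (exists (a : 'I_n) (c : seq 'I_n),
      let L := a :: c in
      let P := zip L c in
      [/\ sorted ltn (map val L) && (2 <= size c)%N,
       has_edge T a (last a c),
       all (fun p => has_edge T p.1 p.2) (take (size P).-1 P),
       has_edge G (last (a, a) P).1 (last (a, a) P).2 &
       noncrossing (T :|: eset (last (a, a) P).1 (last (a, a) P).2)])].

Definition is_cyc (H : graph) (L : seq 'I_n) : bool :=
  [&& uniq L, (3 <= size L)%N & path.cycle (adj H) L].
Definition cyc_edges (L : seq 'I_n) : {set edge} :=
  \bigcup_(p <- zip L (rot 1 L)) eset p.1 p.2.

Definition cycdata (G H : graph) (a : 'I_n) (c : seq 'I_n) : Prop :=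
  [/\ sorted ltn (map val (a :: c)) && (2 <= size c)%N, H \subset G,
      connected H && noncrossing H, is_cyc H (a :: c) &
      forall L, is_cyc H L -> cyc_edges L = cyc_edges (a :: c)].

(* T_(j+1) for j = 0 .. m-1:  T_1 = H \ i_1 i_m,  T_(j+1) = H \ i_j i_(j+1) *)
Definition Tj (H : graph) (a : 'I_n) (c : seq 'I_n) (j : nat) : graph :=
  if j == 0%N then H :\: eset a (last a c)
  else H :\: eset (nth a (a :: c) j.-1) (nth a (a :: c) j).

(* coefficient vector of  x_(T_m) - x_(T_1) + x_(T_2) + ... + x_(T_(m-1))  (= 0) *)
Definition rho (H : graph) (a : 'I_n) (c : seq 'I_n) (T : graph) : rat :=
  (T == Tj H a c (size c))%:R - (T == Tj H a c 0)%:R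
  + \sum_(1 <= j < size c) (T == Tj H a c j)%:R.

Definition comb (v : graph -> rat) : fsum :=
  \big[cat/[::]]_(T : graph) scaleF (v T) (xT T).

Definition step (G : graph) (v v' : graph -> rat) : Prop :=
  exists (H : graph) (a : 'I_n) (c : seq 'I_n),
    [/\ cycdata G H a c, v (Tj H a c (size c)) != 0 &
        forall T, v' T = v T - v (Tj H a c (size c)) * rho H a c T].

End FK.

(* Main.v *)
(* Work with words in the edges of the complete graph.  A word of length n - 1
   has product (1 2 ... n) exactly when its edges connect [n] and every pair
   e, f of letters, e before f, is such that f does not join the two arcs into
   which e cuts the cycle.  Hence the simple words for sigma are, up to
   commutations, the words of noncrossing trees.
   Sending x_T to the product of 1/(z_a - z_b) over the edges a < b of T kills
   the ideal, and the cycle relations become the telescoping identity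
   z_{i_1} - z_{i_m} = sum (z_{i_{j-1}} - z_{i_j}).
   Independence: for any graph G, the rational functions attached to the
   noncrossing edge sets without broken cycle are linearly independent.  Let
   e0 = ab be the edge of G with b, then a, minimal.  Taking the residue along
   z_a = z_b turns the sets containing e0 into sets of the same kind for the
   graph with a merged into b, injectively; induct on the number of edges.
   For the complete graph, straightening by the three-term relation alone
   already spans by the reduced trees.  So a combination of the x_T vanishes as
   soon as its rational functions cancel; this yields the cycle relations for
   all G, which in turn rewrite every x_T to reduced trees because each step
   increases the total weight of the edges. *)
Require Import Defs.
From HB Require Import structures.
From mathcomp Require Import all_boot all_order all_fingroup all_algebra.
From mathcomp Require Import zify ring.
From Stdlib Require Import Relations Classical Wf_nat.
Set Implicit Arguments.
Unset Strict Implicit.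
Unset Printing Implicit Defensive.
Import Order.TTheory GRing.Theory Num.Theory.
Local Open Scope ring_scope.

(** * The ideal of relations *)

(** For a proper subgraph $G$ the three-term relation alone does not suffice: rewriting
    $x_{ac}x_{ab}$ brings in the edge $bc$, which $G$ may lack. The cycle relations of $G$ are
    therefore never derived inside $G$. They are read off from rational functions, which is
    legitimate because over the complete graph, where the edge $bc$ is always available, the reduced
    trees span and their functions are independent. One order on edges governs the whole proof:
    compare larger ends, then smaller ends. On an increasing cycle $i_1<\dots<i_m$ the edge
    $i_{m-1}i_m$ is the largest, so a reduced tree avoids certain broken circuits, as in the nbc
    bases of matroid theory. This is why the contracted edge is the smallest one, and why trading
    $T_m$ for the other $T_j$ increases weight. Unlike in the matroid case, only increasing cycles
    whose closing edge crosses nothing are forbidden, so the injectivity of contraction needs an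
    argument of its own. *)

Section Ideal.
Variable n : nat.
Implicit Types (u v w : word n) (f g : fsum n) (h : word n -> rat).

Lemma coeff_cat f g w : coeff (f ++ g) w = coeff f w + coeff g w.
Proof. by rewrite /coeff big_cat. Qed.

Lemma coeff_nil w : coeff [::] w = 0.
Proof. by rewrite /coeff big_nil. Qed.

Lemma coeffE f w : coeff f w = \sum_(p <- f) p.1 * (p.2 == w)%:R.
Proof.
rewrite /coeff big_mkcond; apply: eq_bigr => p _.
by case: eqP; rewrite ?mulr1 ?mulr0.
Qed.

Lemma coeff_scale k f w : coeff (scaleF k f) w = k * coeff f w.
Proof. by rewrite !coeffE big_map mulr_sumr; apply: eq_bigr => p _ /=; rewrite mulrA. Qed.

Lemma coeff_mono u w : coeff (monoF u) w = (u == w)%:R.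
Proof. by rewrite coeffE big_seq1 mul1r. Qed.

Lemma coeff_comb (c : graph n -> rat) w :
  coeff (comb c) w = \sum_(T : graph n) c T * coeff (xT T) w.
Proof.
rewrite /comb (big_morph (fun f => coeff f w) (id1 := 0) (op1 := +%R)).
- by apply: eq_bigr => T _; rewrite coeff_scale.
- by move=> f g; rewrite coeff_cat.
- exact: coeff_nil.
Qed.

(* [inI f] is convertible to [ideal_coeff (coeff f)]. *)
Definition ideal_coeff h : Prop :=
  exists s : seq ((rat * word n) * fsum n * word n),
    (forall t, t \in s -> is_rel t.1.2) /\
    forall w, h w =
      coeff (flatten [seq mulF (mulF [:: t.1.1] t.1.2) (monoF t.2) | t <- s]) w.

Lemma ideal_ext h1 h2 : h1 =1 h2 -> ideal_coeff h1 -> ideal_coeff h2.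
Proof. by move=> E [s [sP sE]]; exists s; split=> // w; rewrite -E. Qed.

Lemma ideal0 : ideal_coeff (fun=> 0).
Proof. by exists [::]; split=> // w; rewrite coeff_nil. Qed.

Lemma idealD h1 h2 :
  ideal_coeff h1 -> ideal_coeff h2 -> ideal_coeff (fun w => h1 w + h2 w).
Proof.
move=> [s [sP sE]] [t [tP tE]]; exists (s ++ t); split.
  by move=> x; rewrite mem_cat => /orP[/sP|/tP].
by move=> w; rewrite map_cat flatten_cat coeff_cat sE tE.
Qed.

Lemma coeff_mul3 (k : rat) u r v w :
  coeff (mulF (mulF [:: (k, u)] r) (monoF v)) w =
  k * \sum_(p <- r) p.1 * (u ++ p.2 ++ v == w)%:R.
Proof.
rewrite coeffE /mulF /= cats0 big_flatten !big_map mulr_sumr.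
apply: eq_bigr => p _; rewrite big_seq1 /= mulr1 mulrA catA //.
Qed.

Lemma idealZ k h : ideal_coeff h -> ideal_coeff (fun w => k * h w).
Proof.
move=> [s [sP sE]].
exists [seq (((k * t.1.1.1, t.1.1.2), t.1.2), t.2) | t <- s]; split.
  by move=> x /mapP[t /sP ? ->].
move=> w; rewrite {}sE; elim: s {sP} => [|[[[q u] r] v] s IH] /=.
  by rewrite coeff_nil mulr0.
by rewrite !coeff_cat mulrDr IH !coeff_mul3 mulrA.
Qed.

Lemma ideal_sum (I : Type) (r : seq I) (P : pred I) (F : I -> word n -> rat) :
  (forall i, P i -> ideal_coeff (F i)) ->
  ideal_coeff (fun w => \sum_(i <- r | P i) F i w).
Proof.
move=> H; elim: r => [|i r IH].
  by apply: ideal_ext ideal0 => w; rewrite big_nil.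
case Pi: (P i); last by apply: ideal_ext IH => w; rewrite big_cons Pi.
by apply: ideal_ext (idealD (H _ Pi) IH) => w; rewrite big_cons Pi.
Qed.

Lemma ideal_rel u r v : is_rel r ->
  ideal_coeff (fun w => \sum_(p <- r) p.1 * (u ++ p.2 ++ v == w)%:R).
Proof.
move=> rP; exists [:: (((1, u), r), v)]; split.
  by move=> t; rewrite inE => /eqP ->.
by move=> w; rewrite [flatten _]cats0 coeff_mul3 mul1r.
Qed.

Lemma congrE f g : congr f g <-> ideal_coeff (fun w => coeff f w - coeff g w).
Proof.
by split; apply: ideal_ext => w; rewrite coeff_cat coeff_scale mulN1r.
Qed.

Definition evalF (phi : word n -> rat) f : rat := \sum_(p <- f) p.1 * phi p.2.

(** A formal sum may list a word several times; regrouping it along a duplicate-free list of words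
    leaves only coefficients. *)
Lemma evalF_ext phi f g : coeff f =1 coeff g -> evalF phi f = evalF phi g.
Proof.
move=> E; pose U := undup ([seq p.2 | p <- f] ++ [seq p.2 | p <- g]).
have key x : {subset [seq p.2 | p <- x] <= U} ->
    evalF phi x = \sum_(w <- U) coeff x w * phi w.
  move=> sub; under eq_bigr do rewrite /coeff mulr_suml.
  rewrite (exchange_big_dep predT) //= /evalF big_seq [RHS]big_seq.
  apply: eq_bigr => p px.
  under eq_bigl do rewrite eq_sym.
  rewrite -big_filter filter_pred1_uniq ?undup_uniq ?big_seq1 //.
  exact/sub/map_f.
rewrite !key; first by apply: eq_bigr => w _; rewrite E.
  by move=> w wg; rewrite mem_undup mem_cat wg orbT.
by move=> w wg; rewrite mem_undup mem_cat wg.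
Qed.

Lemma evalF_cat phi f g : evalF phi (f ++ g) = evalF phi f + evalF phi g.
Proof. by rewrite /evalF big_cat. Qed.

Lemma evalF_scale phi k f : evalF phi (scaleF k f) = k * evalF phi f.
Proof. by rewrite /evalF big_map mulr_sumr; apply: eq_bigr => p _; rewrite mulrA. Qed.

Lemma evalF_comb phi c :
  evalF phi (comb c) = \sum_(T : graph n) c T * phi (map (@gen_of_edge n) (xword T)).
Proof.
rewrite /comb (big_morph (evalF phi) (id1 := 0) (op1 := +%R)).
- by apply: eq_bigr => T _; rewrite evalF_scale /evalF big_seq1 mul1r.
- by move=> f g; rewrite evalF_cat.
- by rewrite /evalF big_nil.
Qed.

(** A linear functional on words that kills every $u\,r\,v$ descends to the quotient algebra; this
    is how rational functions are attached to elements of it. *)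
Lemma evalF_congr phi f g :
  (forall u r v, is_rel r -> \sum_(p <- r) p.1 * phi (u ++ p.2 ++ v) = 0) ->
  congr f g -> evalF phi f = evalF phi g.
Proof.
move=> H [s [sP /(@evalF_ext phi) E]].
apply/eqP; rewrite -subr_eq0 -mulN1r -evalF_scale -evalF_cat E; apply/eqP.
elim: s sP {E} => [|[[[k u] r] v] s IH] sP /=; first by rewrite /evalF big_nil.
rewrite evalF_cat IH; last by move=> t ts; apply: sP; rewrite inE ts orbT.
rewrite addr0 /evalF /mulF /= cats0 big_flatten !big_map.
transitivity (k * \sum_(p <- r) p.1 * phi (u ++ p.2 ++ v)); last first.
  by rewrite (H u r v (sP _ (mem_head _ _))) mulr0.
rewrite mulr_sumr; apply: eq_bigr => p _; rewrite big_seq1 /= mulr1 mulrA catA //.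
Qed.

End Ideal.

(** * Factorizations of the long cycle *)

Section Transpositions.
Variable n : nat.
Implicit Types (s u v : seq ('I_n * 'I_n)) (p : 'I_n * 'I_n).

Definition tprod s : {perm 'I_n} :=
  foldr (fun p t => (t * tperm p.1 p.2)%g) 1%g s.

Lemma sigmaPE (w : word n) : sigmaP w = tprod (map val w).
Proof. by rewrite /sigmaP /tprod foldr_map. Qed.

Lemma tprod_cat s u : tprod (s ++ u) = (tprod u * tprod s)%g.
Proof. by elim: s => [|p s IH] /=; rewrite ?mulg1 // IH mulgA. Qed.

Lemma tprodJ s (g : {perm 'I_n}) :
  (tprod s ^ g)%g = tprod [seq (g p.1, g p.2) | p <- s].
Proof. by elim: s => [|p s IH] /=; rewrite ?conj1g // conjMg IH tpermJ. Qed.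

Lemma porbits_mul_tpermr (s : {perm 'I_n}) (x y : 'I_n) :
  (#|porbits (s * tperm x y)%g| + (x \notin porbit s y).*2 =
   #|porbits s| + (x != y))%N.
Proof.
rewrite -porbitsV invMg tpermV -(porbitsV s) -porbits_mul_tperm.
by rewrite porbitV.
Qed.

Lemma card_porbits1 : #|porbits (1 : {perm 'I_n})| = n.
Proof.
have E x : porbit (1 : {perm 'I_n}) x = [set x].
  apply/setP => y; rewrite inE; apply/porbitP/eqP => [[i]|->].
    by rewrite expg1n perm1.
  by exists 0%N; rewrite perm1.
rewrite card_imset ?card_ord // => x y; rewrite !E => /setP/(_ x).
by rewrite !inE eqxx => /esym/eqP.
Qed.

(** Each transposition lowers the number of cycles by at most one, starting from the $n$ fixed
    points of the identity. *)
Lemma card_porbits_tprod s : (n <= #|porbits (tprod s)| + size s)%N.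
Proof.
elim: s => [|p s IH] /=; first by rewrite card_porbits1 addn0.
have := porbits_mul_tpermr (tprod s) p.1 p.2.
set k := #|_|; move: IH; set l := #|_|.
have [->|_] := eqVneq p.1 p.2; first by rewrite porbit_id /=; lia.
by case: (_ \notin _) => /=; lia.
Qed.

Lemma porbit_sub (t : {perm 'I_n}) (A : pred 'I_n) (x y : 'I_n) :
  (forall z, A (t z) = A z) -> x \in porbit t y -> A x = A y.
Proof.
move=> H /porbitP[i ->]; elim: i => [|i IH]; first by rewrite perm1.
by rewrite expgSr permM H.
Qed.

Lemma sigma_longE (i : 'I_n) : sigma_long n i = ordS i.
Proof. by rewrite permE. Qed.

Lemma card_porbits_long : (0 < n)%N -> #|porbits (sigma_long n)| = 1%N.
Proof.
move=> n0; pose z : 'I_n := Ordinal n0.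
have H (x : 'I_n) : x \in porbit (sigma_long n) z.
  apply/porbitP; exists (val x); case: x; elim=> [|k IH] kn.
    by rewrite perm1; apply/val_inj.
  rewrite expgSr permM -(IH (ltnW kn)) sigma_longE; apply/val_inj => /=.
  by rewrite modn_small.
rewrite -(cards1 (porbit (sigma_long n) z)); congr #|pred_of_set _|.
apply/setP => A; rewrite inE; apply/imsetP/eqP => [[x _ ->]|->]; last by exists z.
by apply/eqP; rewrite eq_porbit_mem.
Qed.

(* Moving the two marked transpositions to one end by conjugating the letters they cross. *)
Lemma card_porbits_subword (u v m : seq ('I_n * 'I_n)) (e f : 'I_n * 'I_n) :
  (n <= #|porbits (tprod (u ++ e :: m ++ f :: v) * tperm e.1 e.2
         * tperm f.1 f.2)%g| + (size u + size m + size v))%N.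
Proof.
set E := tperm e.1 e.2; set F := tperm f.1 f.2.
have -> : (tprod (u ++ e :: m ++ f :: v) * E * F =
           tprod v * ((tprod m * tprod u ^ E) ^ F))%g.
  rewrite tprod_cat /= tprod_cat /= -/E -/F !conjgE !tpermV !mulgA.
  by rewrite -!mulgA.
rewrite (tprodJ u) -tprod_cat tprodJ -tprod_cat.
set r := (X in tprod X); apply: leq_trans (card_porbits_tprod r) _.
by rewrite leq_add2l /r !size_cat !size_map !size_cat !size_map.
Qed.

End Transpositions.

(** * Arcs cut out by edges, and minimal factorizations of the long cycle *)

Section Arcs.
Variable n : nat.
Implicit Types (e f : edge n) (s : seq (edge n)) (T H : graph n).

Definition inarc e (x : 'I_n) : bool := ((val e).1 <= x < (val e).2)%N.
Definition inarc' e (x : 'I_n) : bool := ((val e).1 < x <= (val e).2)%N.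

(* Cutting the cycle (1 2 ... n) with the transposition [e] leaves the two
   cycles [inarc e] and its complement, and [ok e f] says that [f] cuts one of
   them again: this is the exact condition for [e] to precede [f] in a minimal
   factorization. *)
Definition ok e f : bool := inarc e (val f).1 == inarc e (val f).2.

Definition ewt (s : seq (edge n)) : {perm 'I_n} := tprod (map val s).

Lemma edge_lt e : ((val e).1 < (val e).2)%N. Proof. exact: (valP e). Qed.

Lemma okE e f : ok e f = (inarc' f (val e).1 == inarc' f (val e).2).
Proof.
rewrite /ok /inarc /inarc'; move: (val e) (val f) (edge_lt e) (edge_lt f).
by move=> [a b] [c d] /=; lia.
Qed.

(** The primed arc is the plain one moved one place along the cycle; where the successor wraps
    around, both sides are false. *)
Lemma inarc_ordS e (x : 'I_n) : inarc' e (ordS x) = inarc e x.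
Proof.
have /= b := ltn_ord (val e).2; rewrite /inarc /inarc' /=; have xn := ltn_ord x.
have [lt|ge] := ltnP x.+1 n; first by rewrite modn_small //; lia.
have E : x.+1 = n by lia.
by rewrite E modnn; lia.
Qed.

Lemma adj_sym H a b : adj H a b = adj H b a.
Proof.
by apply: eq_existsb => e; congr (_ && _); rewrite orbC.
Qed.

Lemma adjP H a b :
  reflect (exists2 e, e \in H & val e = (a, b) \/ val e = (b, a)) (adj H a b).
Proof.
apply: (iffP existsP) => [[e /andP[eH /orP[]/eqP E]]|[e eH E]].
- by exists e => //; left.
- by exists e => //; right.
- by exists e; rewrite eH /=; case: E => ->; rewrite eqxx ?orbT.
Qed.

Lemma adj_edge H e : e \in H -> adj H (val e).1 (val e).2.
Proof. by move=> eH; apply/adjP; exists e => //; left; case: (val e). Qed.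

Lemma connectedP H : reflect (forall a b, connect (adj H) a b) (connected H).
Proof. exact: 'forall_forallP. Qed.

Lemma connected_closed H (A : pred 'I_n) : connected H ->
  (forall e, e \in H -> A (val e).1 = A (val e).2) -> forall x y, A x = A y.
Proof.
move=> /connectedP cH HA x y.
apply: (closed_connect _ (cH x y)) => a b /adjP[e /HA + E].
by case: E => -> /=.
Qed.

(** If no edge separated $x<y$, the interval $(x,y]$ would be closed under adjacency, although it
    contains $y$ and not $x$. *)
Lemma inarc_inj H (x y : 'I_n) : connected H ->
  (forall e, e \in H -> inarc e x = inarc e y) -> x = y.
Proof.
move=> cH; wlog lexy : x y / (x <= y)%N => [W E|E].
  by case/orP: (leq_total x y) => le; [|symmetry]; apply: W => // e /E.
apply/val_inj/eqP; rewrite eqn_leq lexy leqNgt /=; apply/negP => ltxy.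
suff : (x < x <= y)%N = (x < y <= y)%N by lia.
apply: (@connected_closed H (fun z : 'I_n => (x < z <= y)%N)) => // e eH.
have := E e eH; have := edge_lt e; rewrite /inarc.
by move: (val e).1 (val e).2 => a b; lia.
Qed.

(** The inverse permutation of [ewt s], applied letter by letter: here the first letter acts first,
    whereas in [ewt s] it acts last. *)
Definition walk (p : 'I_n) s : 'I_n :=
  foldl (fun p e => tperm (val e).1 (val e).2 p) p s.

Lemma walkK s p : ewt s (walk p s) = p.
Proof.
rewrite /ewt; elim: s p => [|e s IH] p /=; first by rewrite perm1.
by rewrite permM IH tpermK.
Qed.

Lemma walk_inv (P : edge n -> bool) r s p :
  (forall f, f \in r -> inarc f p = P f) ->
  (forall f, f \in s -> inarc' f p = P f) ->
  (forall f e, f \in r -> e \in s -> ok f e) -> pairwise ok s ->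
  forall f, f \in r ++ s -> inarc f (walk p s) = P f.
Proof.
elim: s r p => [|e s IH] r p Hr Hs Hok /=; first by rewrite cats0.
move=> /andP[/allP es ps] f fI.
have step (A : pred 'I_n) : A (val e).1 = A (val e).2 ->
    A (tperm (val e).1 (val e).2 p) = A p.
  by case: tpermP => // ->.
apply: (IH (e :: r)) => // [g|g gs|g h|].
- rewrite inE => /orP[/eqP ->|gr].
    rewrite -(Hs e (mem_head _ _)); have /= lt := edge_lt e.
    case: tpermP => [->|->|]; rewrite /inarc /inarc' /=; try lia.
    by move=> /eqP; rewrite -val_eqE /= => ? /eqP; rewrite -val_eqE /= => ?; lia.
  by rewrite step ?Hr //; apply/eqP/Hok; rewrite // mem_head.
- rewrite step ?Hs ?inE ?gs ?orbT //.
  by apply/eqP; rewrite -okE es.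
- rewrite inE => /orP[/eqP ->|gr] hs; first exact: es.
  by apply: Hok; rewrite // inE hs orbT.
- by move: fI; rewrite !mem_cat !inE orbCA orbA.
Qed.

(** The walk from the successor of [i] ends at a point lying in the same arcs as [i], and the arcs
    of a connected graph separate points. *)
Lemma ok_ewt H s : connected H -> {subset H <= s} -> pairwise ok s ->
  ewt s = sigma_long n.
Proof.
move=> cH sub ps; apply/permP => i; rewrite sigma_longE.
suff E : walk (ordS i) s = i by rewrite -{1}E walkK.
apply: (inarc_inj cH) => e eH.
apply: (@walk_inv (fun e => inarc e i) [::]) => //; last exact: sub.
by move=> f _; rewrite inarc_ordS.
Qed.

Lemma connect_ewt s x : connect (adj [set e in s]) x (ewt s x).
Proof.
rewrite /ewt; elim: s => [|e s IH] /=; first by rewrite perm1.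
have sub : connect (adj [set f in s]) x (tprod (map val s) x) ->
    connect (adj [set f in e :: s]) x (tprod (map val s) x).
  apply: connect_sub => a b /adjP[f fs E]; apply/connect1/adjP; exists f => //.
  by move: fs; rewrite !inE => ->; rewrite orbT.
apply: connect_trans (sub IH) _; rewrite permM.
have eI : e \in [set f in e :: s] by rewrite !inE eqxx.
case: tpermP => [->|->|//]; apply: connect1; first exact: adj_edge.
by rewrite adj_sym adj_edge.
Qed.

Lemma ewt_connected s : ewt s = sigma_long n -> connected [set e in s].
Proof.
move=> E; have S x : connect (adj [set e in s]) x (ordS x).
  by rewrite -sigma_longE -E connect_ewt.
have sym := sym_connect_sym (adj_sym [set e in s]).
apply/connectedP => a b.
have n0 : (0 < n)%N by apply: leq_ltn_trans (ltn_ord a).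
suff H (x : 'I_n) : connect (adj [set e in s]) (Ordinal n0) x.
  by apply: connect_trans (H b); rewrite sym.
case: x; elim=> [|k IH] kn.
  by rewrite (_ : Ordinal kn = Ordinal n0) //; apply/val_inj.
apply: connect_trans (IH (ltnW kn)) _.
have -> : Ordinal kn = ordS (Ordinal (ltnW kn)); last exact: S.
by apply/val_inj; rewrite /= modn_small.
Qed.

(** If [f] joined the two cycles of $\sigma e$, then $\sigma e f$ would have a single cycle. Up to
    conjugation it is the word with [e] and [f] deleted, that is, $n-3$ transpositions, which leave
    at least three cycles. *)
Lemma ewt_ok s : ewt s = sigma_long n -> size s = n.-1 -> pairwise ok s.
Proof.
move=> E sz.
have key u e m f v : s = u ++ e :: m ++ f :: v -> ok e f.
  move=> sE; apply/negPn/negP => nok.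
  have := card_porbits_subword (map val u) (map val v) (map val m) (val e) (val f).
  have -> : map val u ++ val e :: map val m ++ val f :: map val v = map val s.
    by rewrite sE map_cat /= map_cat.
  rewrite -/(ewt s) E !size_map.
  have := porbits_mul_tpermr (sigma_long n * tperm (val e).1 (val e).2)%g (val f).1 (val f).2.
  have := porbits_mul_tpermr (sigma_long n) (val e).1 (val e).2.
  rewrite card_porbits_long; last exact: leq_ltn_trans (ltn_ord (val e).1).
  (* The arc of [e] is stable under $\sigma e$, and [f] has one end inside it and one outside. *)
  have -> : (val f).1 \notin porbit (sigma_long n * tperm (val e).1 (val e).2)%g (val f).2.
    apply/negP => /porbit_sub H; move/negP: nok; apply; apply/eqP/H => z.
    rewrite permM sigma_longE -(inarc_ordS e z); have /= lt := edge_lt e.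
    case: tpermP => [->|->|]; rewrite /inarc /inarc' /=; try lia.
    by move=> /eqP; rewrite -val_eqE /= => ? /eqP; rewrite -val_eqE /= => ?; lia.
  move: sz; rewrite sE !size_cat /= size_cat /=.
  set x := #|_|; set y := #|_|; rewrite -!muln2; move: x y => x y.
  move: (_ \notin _) (_ != _) (_ != _) => b1 b2 b3.
  have := leq_b1 b2; have := leq_b1 b3; clear.
  move: (nat_of_bool b1) (nat_of_bool b2) (nat_of_bool b3) (size u) (size m) (size v) => *.
  by lia.
suff key' t : forall u, s = u ++ t -> pairwise ok t by exact: (key' s [::]).
elim: t => [|e t IH] u tE //=.
rewrite (IH (rcons u e)) ?cat_rcons ?tE // andbT; apply/allP => f ft.
case/splitPr: ft tE => m v tE; exact: (key u e m f v).
Qed.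

End Arcs.

(** * Spanning trees and cycles *)

Section Graphs.
Variable n : nat.
Implicit Types (e f : edge n) (s : seq (edge n)) (S T H : graph n).
Implicit Types (L p : seq 'I_n) (x y : 'I_n) (V : {set 'I_n}).

Lemma edgeP e f x y : (val e = (x, y) \/ val e = (y, x)) ->
  (val f = (x, y) \/ val f = (y, x)) -> e = f.
Proof.
have := edge_lt e; have := edge_lt f => + + E F.
by case: E F => E [] F; rewrite F E => /= l1 l2;
  (try by apply: val_inj; rewrite E F); lia.
Qed.

Lemma esetE e x y :
  (e \in eset x y) = (val e == (x, y)) || (val e == (y, x)).
Proof. by rewrite inE. Qed.

Lemma eset_edge e : eset (val e).1 (val e).2 = [set e].
Proof.
apply/setP => f; rewrite esetE inE -surjective_pairing; apply/idP/eqP => [|->].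
  move=> /orP H; apply: (@edgeP _ _ (val e).1 (val e).2).
    by case: H => /eqP ->; [left|right]; rewrite -?surjective_pairing.
  by left; rewrite -surjective_pairing.
by rewrite eqxx.
Qed.

Lemma esetC x y : eset x y = eset y x.
Proof. by apply/setP => e; rewrite !esetE orbC. Qed.

Lemma eset1 e x y : e \in eset x y -> eset x y = [set e].
Proof.
by rewrite esetE => /orP[]/eqP E; rewrite -(eset_edge e) E //= esetC.
Qed.

Lemma adj_eset H x y : adj H x y = has_edge H x y.
Proof.
apply/adjP/set0Pn => [[e eH E]|[e]].
  by exists e; rewrite inE eH esetE andbT; case: E => ->; rewrite eqxx ?orbT.
by rewrite inE esetE => /andP[/orP[]/eqP E eH]; exists e; tauto.
Qed.

Lemma adj_in H e x y : adj H x y -> e \in eset x y -> e \in H.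
Proof.
move=> /adjP[f fH F]; rewrite esetE => /orP E.
rewrite (@edgeP e f x y) //; by case: E => /eqP; [left|right].
Qed.

Lemma adjD1 H e x y : adj (H :\ e) x y = adj H x y && (e \notin eset x y).
Proof.
apply/adjP/andP => [[f]|[/adjP[f fH F] ne]].
  rewrite !inE => /andP[fe fH] F; split; first by apply/adjP; exists f.
  apply: contra fe => /orP E; apply/eqP/(@edgeP _ _ x y) => //.
  by case: E => /eqP; [left|right].
exists f => //; rewrite !inE fH andbT; apply: contra ne => /eqP <-.
by rewrite esetE; case: F => ->; rewrite eqxx ?orbT.
Qed.

Lemma connected_sub S H : S \subset H -> connected S -> connected H.
Proof.
move=> sub /connectedP cS; apply/connectedP => a b.
apply: connect_sub (cS a b) => x y /adjP[e /(subsetP sub) eH E].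
by apply/connect1/adjP; exists e.
Qed.

Lemma connectedD1 H e : connected H ->
  connect (adj (H :\ e)) (val e).1 (val e).2 -> connected (H :\ e).
Proof.
move=> /connectedP cH ce; apply/connectedP => a b.
apply: connect_sub (cH a b) => x y xy.
case E: (e \notin eset x y); first by apply: connect1; rewrite adjD1 xy.
move: E => /negbFE; rewrite esetE => /orP[]/eqP E; move: ce; rewrite E //=.
by rewrite (sym_connect_sym (adj_sym _)).
Qed.

(** Growing a vertex set along edges of a connected graph that leave it, with an arbitrary
    invariant. It serves twice: for spanning trees, and for admissible orders of edges, where each
    step adds a leaf. *)
Lemma grow T (P : {set 'I_n} -> graph n -> Prop) : connected T ->
  (forall V S e x y, P V S -> e \in T -> (val e = (x, y) \/ val e = (y, x)) ->
     x \in V -> y \notin V -> P (y |: V) (e |: S)) ->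
  forall V S x, x \in V -> P V S -> exists S', P setT S'.
Proof.
move=> cT step V; move: {-1}(#|~: V|) (leqnn #|~: V|) => k.
elim: k V => [|k IH] V Vk S x xV PV.
  exists S; suff <- : V = setT by [].
  by move: Vk; rewrite leqn0 cards_eq0 -{2}(setCK V) => /eqP ->; rewrite setC0.
have [VT|] := eqVneq V setT; first by exists S; rewrite -VT.
rewrite -subTset => /subsetPn[z _ zV].
have [e eT eV] : exists2 e, e \in T & ((val e).1 \in V) != ((val e).2 \in V).
  apply/exists_inP; apply: contraT; rewrite negb_exists_in => /forall_inP Hn.
  suff: (x \in V) = (z \in V) by rewrite xV (negbTE zV).
  by apply: (connected_closed cT) => e /Hn; rewrite negbK => /eqP.
have [y [w [E yV wV]]] : exists y w, [/\ val e = (y, w) \/ val e = (w, y),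
    y \in V & w \notin V].
  move: eV; have [h1|h1] := boolP ((val e).1 \in V); have [h2|h2] := boolP ((val e).2 \in V) => // _.
    by exists (val e).1, (val e).2; split => //; left; rewrite -surjective_pairing.
  by exists (val e).2, (val e).1; split => //; right; rewrite -surjective_pairing.
apply: (IH (w |: V) _ (e |: S) y); rewrite ?inE ?yV ?orbT //.
  rewrite -ltnS; apply: leq_trans Vk; apply/proper_card/properP.
  split; first by rewrite setCS subsetUr.
  by exists w; rewrite !inE ?eqxx.
exact: step PV eT E yV wV.
Qed.

Lemma spanning_tree T : (0 < n)%N -> connected T ->
  exists S, [/\ S \subset T, connected S & #|S|.+1 = n].
Proof.
move=> n0 cT.
pose P V S := [/\ S \subset T, (forall e, e \in S -> (val e).1 \in V /\ (val e).2 \in V),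
  #|S|.+1 = #|V| & {in V &, forall x y, connect (adj S) x y}].
have [|||S [sub _ card cS]] :=
  @grow T P cT _ [set Ordinal n0] set0 (Ordinal n0).
- move=> V S e x y [sub inV card cS] eT E xV yV.
  have eS : e \notin S.
    by apply/negP => /inV; case: E yV => -> /= /negP yV [].
  split.
  - by rewrite subUset sub1set eT.
  - move=> f; rewrite !inE => /orP[/eqP ->|/inV[-> ->]]; last by rewrite !orbT.
    by case: E => -> /=; rewrite xV eqxx ?orbT.
  - by rewrite !cardsU1 eS yV -card.
  - have sym := sym_connect_sym (adj_sym (e |: S)).
    have Sx z : z \in y |: V -> connect (adj (e |: S)) x z.
      rewrite !inE => /orP[/eqP ->|zV].
        by apply/connect1/adjP; exists e => //; rewrite setU11.
      apply: connect_sub (cS _ _ xV zV) => a b /adjP[f fS F].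
      by apply/connect1/adjP; exists f => //; rewrite inE fS orbT.
    move=> a b aV bV; apply: connect_trans (Sx _ bV).
    by rewrite sym Sx.
- by rewrite inE.
- split; rewrite ?sub0set // ?cards0 ?cards1 //; first by move=> e; rewrite inE.
  by move=> x y; rewrite !inE => /eqP -> /eqP ->; exact: connect0.
exists S; split => //; last by rewrite card cardsT card_ord.
by apply/connectedP => a b; apply: cS; rewrite inE.
Qed.

Lemma connected_card T : connected T -> (n.-1 <= #|T|)%N.
Proof.
move=> cT; case: (posnP n) => [n0|n0]; first by rewrite {1}n0.
have [S [sub _ card]] := spanning_tree n0 cT.
by rewrite -{1}card subset_leq_card.
Qed.

Lemma path_zip (r : rel 'I_n) x y p :
  path r x (rcons p y) = all (fun q => r q.1 q.2) (zip (x :: p) (rcons p y)).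
Proof. by elim: p x => [|z p IH] x //=; rewrite IH. Qed.

Lemma cycle_zip (r : rel 'I_n) L :
  path.cycle r L = all (fun q => r q.1 q.2) (zip L (rot 1 L)).
Proof. by case: L => [|x p] //=; rewrite rot1_cons path_zip. Qed.

Lemma cyc_edgesP L e :
  reflect (exists2 q, q \in zip L (rot 1 L) & e \in eset q.1 q.2) (e \in cyc_edges L).
Proof.
rewrite /cyc_edges; elim: (zip _ _) => [|q r IH].
  by rewrite big_nil inE; apply: (iffP idP) => // -[].
rewrite big_cons in_setU; apply: (iffP orP) => [[eq|/IH[q' q'r eq']]|[q']].
- by exists q; rewrite ?mem_head.
- by exists q'; rewrite // inE q'r orbT.
- by rewrite inE => /orP[/eqP ->|q'r] eq; [left|right; apply/IH; exists q'].
Qed.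

Lemma is_cyc_edge H L e : is_cyc H L -> e \in cyc_edges L -> e \in H.
Proof.
case/and3P => _ _; rewrite cycle_zip => /allP adjL /cyc_edgesP[q /adjL].
exact: adj_in.
Qed.

Lemma is_cycD1 H L e : is_cyc (H :\ e) L = is_cyc H L && (e \notin cyc_edges L).
Proof.
rewrite /is_cyc -!andbA; congr [&& _, _ & _]; rewrite !cycle_zip.
apply/allP/andP => [A|[/allP A ne] q qL].
  split; first by apply/allP => q /A; rewrite adjD1 => /andP[].
  by apply/cyc_edgesP => -[q /A]; rewrite adjD1 => /andP[_ /negP].
rewrite adjD1 A //=; apply: contra ne => eq; by apply/cyc_edgesP; exists q.
Qed.

Lemma path_adjD1 H e x y p : x \notin y :: p ->
  (val e).1 = x \/ (val e).2 = x -> path (adj H) y p -> path (adj (H :\ e)) y p.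
Proof.
move=> xp ex; elim: p y xp => [|z p IH] y //=; rewrite !inE !negb_or.
move=> /and3P[xy xz xp] /andP[yz pth]; rewrite IH ?inE ?negb_or ?xz // andbT.
rewrite adjD1 yz esetE; apply/norP; split; apply/eqP => E; move: ex xy xz;
  by rewrite E /= => -[] ->; rewrite eqxx.
Qed.

(** After a rotation the deleted edge is the first one of the cycle, and the rest of the cycle is a
    path joining its ends. *)
Lemma connectedD1_cyc H L e : connected H -> is_cyc H L -> e \in cyc_edges L ->
  connected (H :\ e).
Proof.
move=> cH /and3P[uL szL cyL] /cyc_edgesP[[x y] xyL /= exy].
have [i iL [Ex Ey]] : exists2 i, (i < size L)%N &
    x = nth x L i /\ y = nth x (rot 1 L) i.
  move: xyL => /(nthP (x, x))[i]; rewrite size_zip size_rot minnn => iL.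
  by rewrite nth_zip ?size_rot // => -[E1 E2]; exists i => //; split; symmetry.
have : path.cycle (adj H) (rot i L) by rewrite rot_cycle.
have : uniq (rot i L) by rewrite rot_uniq.
have : (3 <= size (rot i L))%N by rewrite size_rot.
have : x = nth x (rot i L) 0.
  by rewrite /rot nth_cat size_drop subn_gt0 iL nth_drop addn0.
have : y = nth x (rot 1 (rot i L)) 0.
  by rewrite rot_rot /rot nth_cat size_drop size_rot subn_gt0 iL nth_drop addn0.
case: (rot i L) => [|x' [|y' p]] //; rewrite rot1_cons /= => <- <- {x' y'}.
move=> sz /andP[]; rewrite inE negb_or => /andP[xy xp] /andP[yp up].
rewrite rcons_path => /and3P[axy pth lx].
apply: connectedD1 => //.
have ex : (val e).1 = x \/ (val e).2 = x.
  by move: exy; rewrite esetE => /orP[]/eqP ->; [left|right].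
have xyp : x \notin y :: p by rewrite inE negb_or xy.
have c1 : connect (adj (H :\ e)) y (last y p).
  by apply/connectP; exists p => //; exact: path_adjD1 xyp ex pth.
(* Length at least three ensures that the closing edge of the cycle is not the deleted edge. *)
have ly : last y p != y.
  case: p sz yp {up pth lx xp xyp c1 Ey} => // z p _; apply: contra => /eqP /= <-.
  exact: mem_last.
have c2 : connect (adj (H :\ e)) y x.
  apply: connect_trans c1 _; apply: connect1; rewrite adjD1 lx.
  apply/negP => h; move: exy h ly; rewrite !esetE.
  by move=> /orP[]/eqP -> /orP[]/eqP E /eqP; move/eqP: xy; congruence.
move: exy; rewrite esetE => /orP[]/eqP -> //=.
by rewrite (sym_connect_sym (adj_sym _)).
Qed.

Lemma cyc_edges_neq0 H L : is_cyc H L -> exists e, e \in cyc_edges L.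
Proof.
case/and3P; case: L => [|x [|y p]] // _ _ /= /andP[/adjP[e eH E] _].
exists e; apply/cyc_edgesP; exists (x, y); first by rewrite rot1_cons mem_head.
by rewrite esetE; case: E => -> /=; rewrite eqxx ?orbT.
Qed.

(** An edge on a cycle could be deleted, leaving too few edges for a connected graph. *)
Lemma tree_acyclic T L : is_tree T -> ~~ is_cyc T L.
Proof.
move=> /andP[cT /eqP card]; apply/negP => cyc.
have [e eL] := cyc_edges_neq0 cyc; have eT := is_cyc_edge cyc eL.
have := connected_card (connectedD1_cyc cT cyc eL).
by have := cardsD1 e T; rewrite eT card /= => ->; rewrite add1n ltnn.
Qed.

(** An edge outside a spanning tree would close a cycle with the tree path between its ends. *)
Lemma acyclic_tree T : connected T -> (forall L, ~~ is_cyc T L) -> is_tree T.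
Proof.
move=> cT ncyc; rewrite /is_tree cT; case: (posnP n) => [n0|n0].
  have -> : T = set0; last by rewrite cards0; apply/eqP; lia.
  by apply/setP => -[[[a an] b] ?]; exfalso; lia.
have [S [sub cS card]] := spanning_tree n0 cT.
suff -> : T = S by apply/eqP; lia.
apply/eqP; rewrite eqEsubset sub andbT; apply/subsetP => e eT.
apply: contraT => eS.
have /connectP[p0 pth lst] := connectedP _ cS (val e).1 (val e).2.
case/shortenP: pth lst => p pth up _ lst.
have := ncyc ((val e).1 :: p); rewrite /is_cyc up /= rcons_path.
have -> : path (adj T) (val e).1 p.
  apply: sub_path pth => a b /adjP[f fS F]; apply/adjP; exists f => //.
  exact: (subsetP sub).
rewrite -lst adj_sym adj_edge //= andbT.
case: p pth up lst => [|z [|]] //=.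
  by move=> _ _ /esym/eqP; rewrite (negbTE (edge_neq e)).
rewrite andbT => az _ zE; move: az; rewrite -zE => /adj_in az.
by case/negP: eS; apply: az; rewrite eset_edge inE.
Qed.

Lemma tree_of_cycle H L e : connected H -> is_cyc H L ->
  (forall L', is_cyc H L' -> cyc_edges L' = cyc_edges L) ->
  e \in cyc_edges L -> is_tree (H :\ e).
Proof.
move=> cH cyc uni eL; apply: acyclic_tree; first exact: connectedD1_cyc eL.
by move=> L'; rewrite is_cycD1; apply/negP => /andP[/uni ->]; rewrite eL.
Qed.

(** Deleting an edge of one cycle that is missing from the other would leave a tree still containing
    the other. *)
Lemma unique_cycle H L L' : connected H -> #|H| = n ->
  is_cyc H L -> is_cyc H L' -> cyc_edges L = cyc_edges L'.
Proof.
move=> cH card; wlog suff W : L L' / is_cyc H L -> is_cyc H L' ->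
    cyc_edges L \subset cyc_edges L'.
  by move=> c c'; apply/eqP; rewrite eqEsubset !W.
move=> c c'; apply/subsetP => e eL; apply: contraT => eL'.
have tr : is_tree (H :\ e).
  rewrite /is_tree (connectedD1_cyc cH c eL) /=.
  by have := cardsD1 e H; rewrite (is_cyc_edge c eL) card => E; apply/eqP; rewrite [in RHS]E.
by have := tree_acyclic L' tr; rewrite is_cycD1 c' eL'.
Qed.

End Graphs.

(** * Admissible orders on the edges of a noncrossing tree *)

Section Orders.
Variable n : nat.
Implicit Types (e f g : edge n) (s u v : seq (edge n)) (T H : graph n).

Definition crossing e f : bool :=
  [&& (val e).1 < (val f).1, (val f).1 < (val e).2 & (val e).2 < (val f).2]%N.

Lemma noncrossingP H :
  reflect {in H &, forall e f, ~~ crossing e f} (noncrossing H).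
Proof.
apply: (iffP forall_inP) => [A e f eH fH|A e eH].
  by move/forall_inP: (A e eH) => /(_ f fH).
by apply/forall_inP => f fH; apply: A.
Qed.

Definition disjoint_edges e f : bool :=
  [&& val (val e).1 != (val f).1, val (val e).1 != (val f).2,
      val (val e).2 != (val f).1 & val (val e).2 != (val f).2].

Ltac edge_lia e f :=
  rewrite /ok /inarc /crossing /disjoint_edges;
  move: (val e) (val f) (edge_lt e) (edge_lt f) => [? ?] [? ?] /=; lia.

Lemma ok_noncrossing e f : ok e f -> ~~ crossing e f /\ ~~ crossing f e.
Proof. edge_lia e f. Qed.

Lemma ok_disjoint e f :
  ~~ crossing e f -> ~~ crossing f e -> disjoint_edges e f -> ok e f.
Proof. edge_lia e f. Qed.

(** Two letters that may stand in either order share no vertex, so their generators commute. *)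
Lemma ok_anti e f : e != f -> ok e f -> ok f e -> disjoint_edges e f.
Proof.
rewrite -val_eqE /=; move: (edge_lt e) (edge_lt f); rewrite /ok /inarc /disjoint_edges /=.
by move: (sval e) (sval f) => [a b] [c d] /=; rewrite xpair_eqE -!val_eqE /=; lia.
Qed.

Lemma disjoint_edgesC e f : disjoint_edges e f = disjoint_edges f e.
Proof. edge_lia e f. Qed.

Lemma ok_irr e : ok e e = false.
Proof. edge_lia e e. Qed.

Lemma ok_total e f : e != f -> ~~ crossing e f -> ~~ crossing f e ->
  ~~ ok e f -> ok f e.
Proof.
rewrite -val_eqE /=; move: (edge_lt e) (edge_lt f); rewrite /ok /inarc /crossing /=.
by move: (sval e) (sval f) => [a b] [c d] /=; rewrite xpair_eqE -!val_eqE /=; lia.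
Qed.

Lemma rankE (i j : 'I_n) :
  rank i j = if (j < i)%N then (i - j)%N else if j == i then 0%N else (i + n - j)%N.
Proof.
rewrite /rank; have i_n := ltn_ord i; have j_n := ltn_ord j.
case: ltnP => [ji|ij]; first by rewrite -addnBAC ?modnDr ?modn_small //; lia.
case: eqP => [->|/eqP]; first by rewrite addnC addnK modnn.
by rewrite -val_eqE /= => ne; rewrite modn_small //; lia.
Qed.

Lemma edge_otherE e a : incident e a -> (a < other e a)%N ->
  val e = (a, other e a).
Proof.
rewrite /other /incident; have := edge_lt e; case: (val e) => p q /=.
case: eqP => [->|_] //= pq /eqP <- qp.
by have := ltn_trans pq qp; rewrite ltnn.
Qed.

Lemma rank_between (a b c d : 'I_n) : (a < b)%N -> (b < c)%N ->
  (rank a d < rank a b)%N -> (rank a c <= rank a d)%N -> (b < d <= c)%N.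
Proof.
move=> ab bc; have c_n := ltn_ord c; have d_n := ltn_ord d.
have gt (x : 'I_n) : (a < x)%N -> rank a x = (a + n - x)%N.
  by move=> ax; rewrite rankE -val_eqE /= ltnNge ltnW //= gtn_eqF.
rewrite (gt b ab) (gt c (ltn_trans ab bc)) rankE -val_eqE /=.
by case: (ltngtP d a) => ?; lia.
Qed.

(** The origin of the sequence $i-1,\dots,1,n,\dots,i+1$: at a common vertex it is precisely the arc
    condition. *)
Lemma ok_rank e f i : e != f -> incident e i -> incident f i ->
  ok e f = (rank i (other e i) < rank i (other f i))%N.
Proof.
rewrite !rankE /incident /other /ok /inarc -val_eqE /=.
have i_n := ltn_ord i; move: (edge_lt e) (edge_lt f); rewrite /=.
move: (sval e) (sval f) => [a b] [c d] /=; have b_n := ltn_ord b; have d_n := ltn_ord d.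
by rewrite xpair_eqE -!val_eqE /= => ? ? ? /orP[]/eqP ? /orP[]/eqP ?; do 6?case: ifP; lia.
Qed.

Lemma not_disjoint e f : ~~ disjoint_edges e f ->
  exists2 i, incident e i & incident f i.
Proof.
rewrite /disjoint_edges /incident !negb_and !negbK.
by case/or4P; rewrite val_eqE => /eqP E; [exists (val e).1|exists (val e).1|exists (val e).2|exists (val e).2];
   rewrite ?E ?eqxx ?orbT // -E eqxx ?orbT.
Qed.

Lemma pairwise_index s : uniq s ->
  pairwise (@ok n) s <->
  {in s &, forall e f, (index e s < index f s)%N -> ok e f}.
Proof.
move=> us; split=> [ps e f es fs lt|A].
  have := elimT (pairwiseP e) ps (index e s) (index f s).
  by rewrite !inE !index_mem !nth_index //; apply.
case: s us A => [//|e0 s] us A; apply/(pairwiseP e0) => i j ilt jlt ij.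
by apply: A; rewrite ?mem_nth // !index_uniq.
Qed.

(** Disjoint noncrossing edges satisfy [ok] both ways and impose nothing; for edges with a common
    vertex the two orders agree by [ok_rank]. *)
Lemma valid_orderP T s : noncrossing T ->
  valid_order T s <-> perm_eq s (enum T) /\ pairwise (@ok n) s.
Proof.
move=> /noncrossingP ncT; rewrite /valid_order.
have base : perm_eq s (enum T) -> uniq s /\ s =i T.
  move=> p; split; first by rewrite (perm_uniq p) enum_uniq.
  by move=> e; rewrite (perm_mem p) mem_enum.
split=> [/andP[p /forall_inP A]|[p]]; have [us sT] := base p.
  split=> //; apply/pairwise_index => // e f es fs lt.
  have ne : e != f by apply: contraTneq lt => ->; rewrite ltnn.
  have [d|/not_disjoint[i ei fi]] := boolP (disjoint_edges e f).
    by rewrite ok_disjoint ?ncT -?sT.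
  rewrite (ok_rank ne ei fi) ltnNge leq_eqVlt negb_or; apply/andP; split.
    apply/negP => /eqP E; have := @ok_total e f; rewrite sT in es; rewrite sT in fs.
  rewrite ne !ncT // (ok_rank ne ei fi) (ok_rank _ fi ei) 1?eq_sym // E ltnn.
  by move/(_ isT isT isT isT).
  apply/negP => h; move: (A f); rewrite -sT => /(_ fs) /forall_inP/(_ e).
  by rewrite -sT es => /(_ isT) /forallP/(_ i); rewrite ei fi h /= => /(ltn_trans lt); rewrite ltnn.
move=> /(pairwise_index us) A; rewrite p /=; apply/forall_inP => e eT.
apply/forall_inP => f fT; apply/forallP => i; apply/implyP => /and3P[ei fi lt].
have ne : e != f by apply: contraTneq lt => ->; rewrite ltnn.
rewrite ltnNge leq_eqVlt negb_or; apply/andP; split.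
  apply: contra ne => /eqP/(congr1 (nth e s)); rewrite !nth_index ?sT // => ->.
  exact: eqxx.
apply/negP => /A; rewrite !sT => /(_ fT eT); rewrite (ok_rank _ fi ei) 1?eq_sym //.
by move/(ltn_trans lt); rewrite ltnn.
Qed.

Lemma pairwise_noncrossing T s : T =i s -> pairwise (@ok n) s -> noncrossing T.
Proof.
move=> sT ps; apply/noncrossingP => e f; rewrite !sT => es fs.
have irr g : ~~ crossing g g by edge_lia g g.
have [->|ne] := eqVneq e f => //.
case/splitPr: es ps fs => s1 s2; rewrite pairwise_cat allrel_consr /=.
case/and3P => /andP[/allP A1 _] _ /andP[/allP A2 _].
rewrite mem_cat inE => /or3P[/A1|/eqP E|/A2] //.
- by case/ok_noncrossing.
- by rewrite E eqxx in ne.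
- by case/ok_noncrossing.
Qed.

(* [f] is the last edge that must precede the new leaf edge [e]. *)
Lemma ok_trans_leaf e f g (y : 'I_n) : incident e y ->
  ~~ incident f y -> ~~ incident g y ->
  ~~ crossing e f -> ~~ crossing f e -> ~~ crossing e g -> ~~ crossing g e ->
  ok g f -> ~~ ok e f -> ok g e.
Proof.
move=> ey fy gy ef fe eg ge okgf nok.
have ne h : ~~ incident h y -> e != h by move=> hy; apply: contraTneq ey => ->.
have gf : g != f by apply: contraTneq okgf => ->; rewrite ok_irr.
have [|/not_disjoint[i ei gi]] := boolP (disjoint_edges e g).
  by rewrite disjoint_edgesC; exact: ok_disjoint.
have [/(ok_disjoint ef fe)|/not_disjoint[j ej fj]] := boolP (disjoint_edges e f).
  by rewrite (negbTE nok).
have ij : i = j.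
  have iy : i != y by apply: contraTneq gi => ->.
  have jy : j != y by apply: contraTneq fj => ->.
  move: ey ei ej iy jy; rewrite /incident.
  by do 3![case/orP => /eqP <-]; rewrite ?eqxx.
move: fj; rewrite -ij => fi.
move: okgf nok; rewrite (ok_rank gf gi fi) (ok_rank (ne _ fy) ei fi) -leqNgt.
by rewrite (ok_rank _ gi ei) 1?eq_sym ?ne //; apply: leq_trans.
Qed.

(** The new edge goes immediately after the last letter that it may not precede. The final clause
    remembers that letter; it is needed to keep two chosen letters adjacent. *)
Lemma insert_leaf T s e (y : 'I_n) : noncrossing T -> {subset s <= T} ->
  e \in T -> incident e y -> (forall f, f \in s -> ~~ incident f y) ->
  pairwise (@ok n) s -> exists s1 s2, [/\ s = s1 ++ s2,
    pairwise (@ok n) (s1 ++ e :: s2) &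
    s1 = [::] \/ exists s0 f, s1 = rcons s0 f /\ ~~ ok e f].
Proof.
move=> /noncrossingP ncT; elim/last_ind: s => [|s f IH] sub eT ey ny ps.
  by exists [::], [::]; split=> //; left.
have sT g : g \in s -> g \in T by move=> gs; apply: sub; rewrite mem_rcons inE gs orbT.
have fT : f \in T by apply: sub; rewrite mem_rcons mem_head.
have: pairwise (@ok n) (s ++ [:: f]) by rewrite cats1.
rewrite pairwise_cat allrel1r /= andbT => /andP[/allP sf ps'].
have [ef|nef] := boolP (ok e f); last first.
  exists (rcons s f), [::]; split; rewrite ?cats0 //; last by right; exists s, f.
  rewrite pairwise_cat ps allrel1r /= !andbT all_rcons; apply/andP; split.
    apply: ok_total nef; rewrite ?ncT //; apply: contraTneq ey => ->.
    by apply: ny; rewrite mem_rcons mem_head.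
  apply/allP => g gs; have gT := sT g gs.
  apply: (ok_trans_leaf ey) (sf g gs) nef; rewrite ?ncT //.
    by apply: ny; rewrite mem_rcons mem_head.
  by apply: ny; rewrite mem_rcons inE gs orbT.
have ny' h : h \in s -> ~~ incident h y.
  by move=> gs; apply: ny; rewrite mem_rcons inE gs orbT.
have [s1 [s2 [sE ps2 last1]]] := IH sT eT ey ny' ps'.
exists s1, (rcons s2 f); split=> //; first by rewrite sE rcons_cat.
have -> : s1 ++ e :: rcons s2 f = (s1 ++ e :: s2) ++ [:: f] by rewrite cats1 rcons_cat.
rewrite pairwise_cat ps2 allrel1r /= !andbT; apply/allP => g.
rewrite mem_cat inE => /or3P[gs|/eqP -> //|gs]; apply: sf; rewrite sE mem_cat gs //.
exact: orbT.
Qed.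

Lemma cat_eq_cat2 (A : Type) (s1 s2 u v : seq A) (x y : A) :
  s1 ++ s2 = u ++ [:: x, y & v] ->
  [\/ exists w, u = s1 ++ w /\ s2 = w ++ [:: x, y & v],
      s1 = rcons u x /\ s2 = y :: v |
      exists w, s1 = u ++ [:: x, y & w] /\ v = w ++ s2].
Proof.
elim: s1 u => [|z s1 IH] [|z' u] /=.
- by move=> ->; constructor 1; exists [::].
- by move=> ->; constructor 1; exists (z' :: u).
- case=> ->; case: s1 IH => [|z' s1] _ /=; first by move=> ->; constructor 2.
  by case=> -> <-; constructor 3; exists s1.
- case=> -> /IH[[w [-> ->]]|[-> ->]|[w [-> ->]]].
  + by constructor 1; exists w.
  + by constructor 2.
  + by constructor 3; exists w.
Qed.

(** Only an insertion point between [ec] and [eb] is troublesome, and then [e] is moved behind [eb].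
    The move could fail only if [e] met both at [a]; the ranks would then put its other end strictly
    between [b] and [c]. *)
Lemma insert_adjacent T e (y a b c : 'I_n) eb ec u v : noncrossing T ->
  val eb = (a, b) -> val ec = (a, c) -> (b < c)%N ->
  (forall f d, f \in T -> val f = (a, d) -> ~~ (b < d < c)%N) ->
  {subset u ++ [:: ec, eb & v] <= T} ->
  e \in T -> incident e y -> (forall f, f \in u ++ [:: ec, eb & v] -> ~~ incident f y) ->
  pairwise (@ok n) (u ++ [:: ec, eb & v]) -> exists u' v',
    pairwise (@ok n) (u' ++ [:: ec, eb & v']) /\
    perm_eq (u' ++ [:: ec, eb & v']) (e :: u ++ [:: ec, eb & v]).
Proof.
move=> nc Eb Ec bc adjac sub eT ey ny ps.
have [s1 [s2 [sE ps' lst]]] := insert_leaf nc sub eT ey ny ps.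
have perm s1' s2' : s1' ++ s2' = u ++ [:: ec, eb & v] ->
    perm_eq (s1' ++ e :: s2') (e :: u ++ [:: ec, eb & v]).
  by move=> <-; rewrite -(cat1s e s2') perm_catCA.
case: (cat_eq_cat2 (esym sE)) => [[w [uE E2]]|[u1 E2]|[w [u1 E2]]].
- exists (s1 ++ e :: w), v.
  by rewrite -catA cat_cons -E2; split=> //; apply: perm.
- have nec : ~~ ok e ec.
    case: lst => [|[s0 [f [+ nef]]]]; rewrite u1; first by move/(congr1 size); rewrite size_rcons.
    by move/rcons_inj => [_ ->].
  have ok1 : ok e eb.
    by move: ps'; rewrite E2 pairwise_cat /= => /and3P[_ _ /andP[/andP[]]].
  have ok2 : ok eb e.
    have eby : ~~ incident eb y by apply: ny; rewrite mem_cat !inE eqxx !orbT.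
    have ecy : ~~ incident ec y by apply: ny; rewrite mem_cat !inE eqxx !orbT.
    have ebT : eb \in T by apply: sub; rewrite mem_cat !inE eqxx !orbT.
    have ecT : ec \in T by apply: sub; rewrite mem_cat !inE eqxx !orbT.
    have neb : e != eb by apply: contraTneq ey => ->.
    have nec' : e != ec by apply: contraTneq ey => ->.
    move/noncrossingP: nc => nc.
    have [|/not_disjoint[i ei bi]] := boolP (disjoint_edges e eb).
      by rewrite disjoint_edgesC => /ok_disjoint; apply; apply: nc.
    have [|/not_disjoint[j ej cj]] := boolP (disjoint_edges e ec).
      by move=> /ok_disjoint H; case/negP: nec; apply: H; apply: nc.
    have ij : i = j.
      have iy : i != y by apply: contraTneq bi => ->.
      have jy : j != y by apply: contraTneq cj => ->.
      move: ey ei ej iy jy; rewrite /incident.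
      by do 3![case/orP => /eqP <-]; rewrite ?eqxx.
    have ia : i = a.
      move: bi cj; rewrite -ij /incident Eb Ec /= => /orP[]/eqP <- // /orP[/eqP //|/eqP cb].
      by rewrite cb ltnn in bc.
    rewrite {}ia in ij ei bi; rewrite -{}ij in ej cj.
    move: ok1 nec; rewrite (ok_rank neb ei bi) (ok_rank nec' ej cj) -leqNgt.
    have -> : other eb a = b by rewrite /other Eb eqxx.
    have -> : other ec a = c by rewrite /other Ec eqxx.
    have ab := edge_lt eb; rewrite Eb /= in ab.
    move=> lt le; have /andP[bd dc] := rank_between ab bc lt le; exfalso.
    have ad : (a < other e a)%N := ltn_trans ab bd.
    have Ee := edge_otherE ei ad.
    have ndc : other e a != c.
      by apply: contraNneq nec' => Ed; rewrite -val_eqE Ee Ec Ed.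
    by move/negP: (adjac e _ eT Ee); apply; rewrite bd ltn_neqAle ndc.
  exists u, (e :: v); split; last first.
    apply: perm_trans (perm (rcons (rcons u ec) eb) v _); last by rewrite -!cats1 -!catA.
    by rewrite -!cats1 -!catA.
  move: ps'; rewrite u1 E2 -cats1 -catA /= !pairwise_cat /= !allrel_consr /= ok2.
  by do ![case/andP | move=> ?]; do ![apply/andP; split] => //.
- exists u, (w ++ e :: s2).
  have -> : u ++ [:: ec, eb & w ++ e :: s2] = s1 ++ e :: s2 by rewrite u1 -catA.
  by split=> //; apply: perm.
Qed.

End Orders.

(** * Words of noncrossing trees modulo the ideal *)

Section TreeWords.
Variable n : nat.
Hypothesis n0 : (0 < n)%N.
Implicit Types (e f g : edge n) (s u v : seq (edge n)) (T H : graph n).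

(** [Q] is any property that leaf insertion can maintain: the trivial one yields an admissible
    order, adjacency of two given letters yields the place to apply the three-term relation. *)
Lemma grow_order T (Q : seq (edge n) -> Prop) s0 (V0 : {set 'I_n}) x0 : is_tree T ->
  (forall s e y, Q s -> {subset s <= T} -> e \in T -> incident e y ->
     (forall f, f \in s -> ~~ incident f y) -> pairwise (@ok n) s ->
     exists s', [/\ Q s', pairwise (@ok n) s' & perm_eq s' (e :: s)]) ->
  Q s0 -> pairwise (@ok n) s0 -> uniq s0 -> {subset s0 <= T} ->
  (forall f i, f \in s0 -> incident f i -> i \in V0) -> x0 \in V0 ->
  (size s0).+1 = #|V0| ->
  exists s, [/\ Q s, pairwise (@ok n) s & perm_eq s (enum T)].
Proof.
move=> /andP[cT /eqP card] step Q0 ok0 u0 sub0 inc0 x0V sz0.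
pose P (V : {set 'I_n}) (_ : graph n) := exists s, [/\ Q s, pairwise (@ok n) s, uniq s &
  [/\ {subset s <= T}, (forall f i, f \in s -> incident f i -> i \in V) &
      (size s).+1 = #|V|]].
have [||_ [s [Qs oks us [sub _ sz]]]] := @grow n T P cT _ V0 set0 x0 x0V.
- move=> V S e x y [s [Qs oks us [sub inc sz]]] eT E xV yV.
  have ey : incident e y.
    by rewrite /incident; case: E => -> /=; rewrite eqxx ?orbT.
  have ny f : f \in s -> ~~ incident f y.
    by move=> fs; apply/negP => /(inc _ _ fs); exact/negP.
  have [s' [Qs' oks' pe]] := step s e y Qs sub eT ey ny oks.
  have es : e \notin s by apply: contraL ey => /ny.
  exists s'; split=> //; first by rewrite (perm_uniq pe) /= es.
  split.
  + by move=> f; rewrite (perm_mem pe) inE => /orP[/eqP ->|/sub].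
  + move=> f i; rewrite (perm_mem pe) !inE => /orP[/eqP ->|fs].
      by rewrite /incident; case: E => -> /= /orP[]/eqP <-; rewrite ?xV ?eqxx ?orbT.
    by move=> /(inc _ _ fs) ->; rewrite orbT.
  + by rewrite (perm_size pe) cardsU1 yV /= sz.
- by exists s0.
exists s; split=> //.
have [||_ E] := @uniq_min_size _ s (enum T) us.
- by move=> e /sub; rewrite mem_enum.
- by rewrite -cardE card -ltnS prednK // sz cardsT card_ord.
by apply: uniq_perm => //; exact: enum_uniq.
Qed.

Lemma valid_order_ex T : nctree T ->
  exists s, perm_eq s (enum T) /\ pairwise (@ok n) s.
Proof.
move=> /andP[tT ncT].
have [||||||||s [_ oks pe]] := @grow_order T (fun=> True) [::] [set Ordinal n0] (Ordinal n0) tT.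
- move=> s e y _ sub eT ey ny oks.
  have [s1 [s2 [-> oks' _]]] := insert_leaf ncT sub eT ey ny oks.
  by exists (s1 ++ e :: s2); split=> //; rewrite -(cat1s e s2) perm_catCA.
- by [].
- by [].
- by [].
- by [].
- by [].
- by rewrite inE.
- by rewrite cards1.
by exists s.
Qed.

Lemma adjacent_order_ex T (a b c : 'I_n) eb ec : nctree T ->
  eb \in T -> ec \in T -> val eb = (a, b) -> val ec = (a, c) -> (b < c)%N ->
  (forall f d, f \in T -> val f = (a, d) -> ~~ (b < d < c)%N) ->
  exists u v, perm_eq (u ++ [:: ec, eb & v]) (enum T) /\
    pairwise (@ok n) (u ++ [:: ec, eb & v]).
Proof.
move=> /andP[tT ncT] bT cT Eb Ec bc adjac.
have ab := edge_lt eb; have ac := edge_lt ec; rewrite Eb Ec /= in ab ac.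
have [||||||||s [[u [v ->]] oks pe]] := @grow_order T
  (fun s => exists u v, s = u ++ [:: ec, eb & v]) [:: ec; eb] [set a; b; c] a tT.
- move=> s e y [u [v ->]] sub eT ey ny oks.
  have [u' [v' [ok' pe]]] := insert_adjacent ncT Eb Ec bc adjac sub eT ey ny oks.
  by exists (u' ++ [:: ec, eb & v']); split=> //; exists u', v'.
- by exists [::], [::].
- by rewrite /= /ok /inarc Eb Ec /=; lia.
- by rewrite /= inE -val_eqE Eb Ec xpair_eqE -!val_eqE /=; lia.
- by move=> e; rewrite !inE => /orP[]/eqP ->.
- move=> f i; rewrite !inE => /orP[]/eqP ->; rewrite /incident ?Eb ?Ec /=.
    by move=> /orP[]/eqP ->; rewrite eqxx ?orbT.
  by move=> /orP[]/eqP ->; rewrite eqxx ?orbT.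
- by rewrite !inE eqxx.
- by rewrite setUC cardsU1 cards2 !inE -!val_eqE /=; lia.
by exists u, v.
Qed.

Definition gw s : word n := map (@gen_of_edge n) s.

Lemma sigmaP_gw s : sigmaP (gw s) = ewt s.
Proof. by rewrite sigmaPE /gw -map_comp. Qed.

Lemma xwordP T : nctree T ->
  perm_eq (xword T) (enum T) /\ pairwise (@ok n) (xword T).
Proof.
move=> ncT; have [s [pe oks]] := valid_order_ex ncT; case/andP: ncT => _ nc.
apply/(valid_orderP _ nc); rewrite /xword.
have: s \in [seq s <- permutations (enum T) | valid_order T s].
  by rewrite mem_filter mem_permutations pe andbT; apply/valid_orderP.
have: all (valid_order T) [seq s <- permutations (enum T) | valid_order T s].
  exact: filter_all.
by case: [seq _ <- _ | _] => //= s' r /andP[].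
Qed.

Lemma ewt_order T s : is_tree T -> perm_eq s (enum T) -> pairwise (@ok n) s ->
  ewt s = sigma_long n /\ size s = n.-1.
Proof.
move=> /andP[cT /eqP card] pe oks; split; last by rewrite (perm_size pe) -cardE.
by apply: (ok_ewt cT) => // e eT; rewrite (perm_mem pe) mem_enum.
Qed.

Lemma tree_of_word s : ewt s = sigma_long n -> size s = n.-1 ->
  [/\ nctree [set e in s], perm_eq s (enum [set e in s]) & pairwise (@ok n) s].
Proof.
move=> E sz; have oks := ewt_ok E sz; have cT := ewt_connected E.
have us : uniq s.
  apply/card_uniqP/eqP; rewrite eqn_leq card_size /= sz -(cardsE (mem s)).
  exact: connected_card.
split=> //; last first.
  by apply: uniq_perm => // [|e]; rewrite ?enum_uniq // mem_enum inE.
rewrite /nctree /is_tree cT cardsE (card_uniqP us) sz eqxx /=.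
by apply: (@pairwise_noncrossing _ _ s) => // e; rewrite inE.
Qed.

(** The scalar absorbs the signs coming from $x_{ij}=-x_{ji}$. *)
Definition weq (k : rat) (w1 w2 : word n) : Prop :=
  ideal_coeff (fun w => (w1 == w)%:R - k * (w2 == w)%:R).

Lemma weq_refl w : weq 1 w w.
Proof. by apply: ideal_ext (ideal0 n) => x; rewrite mul1r subrr. Qed.

Lemma weq_trans k l w1 w2 w3 : weq k w1 w2 -> weq l w2 w3 -> weq (k * l) w1 w3.
Proof.
move=> A /(idealZ k) B; apply: ideal_ext (idealD A B) => w /=.
by rewrite mulrBr addrA subrK mulrA.
Qed.

Lemma weq_swap (u v : word n) e f : disjoint_edges e f ->
  weq 1 (u ++ [:: gen_of_edge e, gen_of_edge f & v])
        (u ++ [:: gen_of_edge f, gen_of_edge e & v]).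
Proof.
move=> d; have := @ideal_rel n u [:: (1, [:: gen_of_edge e; gen_of_edge f]);
  (-1, [:: gen_of_edge f; gen_of_edge e])] v.
have: is_rel [:: (1, [:: gen_of_edge e; gen_of_edge f]);
  (-1, [:: gen_of_edge f; gen_of_edge e])].
  right; right; left; exists (gen_of_edge e), (gen_of_edge f); split=> //.
  have := edge_lt e; have := edge_lt f; move: d; rewrite /disjoint_edges /= !inE -!val_eqE /=.
  by move: (sval e) (sval f) => [a b] [c d] /=; lia.
move=> H /(_ H); apply: ideal_ext => w.
by rewrite !big_cons big_nil addr0 mul1r mulN1r mul1r.
Qed.

Lemma weq_front (u : word n) e p q : (forall f, f \in p -> disjoint_edges f e) ->
  weq 1 (u ++ gw (p ++ e :: q)) (u ++ gw (e :: p ++ q)).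
Proof.
elim: p u => [|f p IH] u d; first exact: weq_refl.
rewrite -[1]mul1r; apply: (@weq_trans _ _ _ (u ++ gw (f :: e :: p ++ q))).
  have := IH (u ++ [:: gen_of_edge f]); rewrite -!catA; apply.
  by move=> h hp; apply: d; rewrite inE hp orbT.
by apply: weq_swap; apply: d; rewrite mem_head.
Qed.

(** Letters standing before the head of [s1] in [s2] stand after it in [s1]; they are compatible
    with it both ways, hence commute with it. So $x_T$ does not depend on the order picked by
    [xword]. *)
Lemma weq_order (u : word n) s1 s2 : uniq s1 -> perm_eq s1 s2 ->
  pairwise (@ok n) s1 -> pairwise (@ok n) s2 -> weq 1 (u ++ gw s2) (u ++ gw s1).
Proof.
elim: s1 u s2 => [|e s1 IH] u s2 /=.
  by move=> _; rewrite perm_sym => /perm_nilP ->; rewrite cats0 => *; exact: weq_refl.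
move=> /andP[es us] pe /andP[/allP es1 ok1] ok2.
have e2 : e \in s2 by rewrite -(perm_mem pe) mem_head.
case/splitPr: e2 pe ok2 => p q pe ok2.
have pe' : perm_eq s1 (p ++ q).
  by rewrite -(perm_cons e) (perm_trans pe) // -(cat1s e q) perm_catCA.
rewrite -[1]mul1r; apply: (@weq_trans _ _ _ (u ++ gw (e :: p ++ q))).
  apply: weq_front => f fp; apply: ok_anti.
  - apply: contraNneq es => <-; by rewrite (perm_mem pe') mem_cat fp.
  - move: ok2; rewrite pairwise_cat allrel_consr => /and3P[/andP[/allP A _] _ _].
    exact: A.
  - by apply: es1; rewrite (perm_mem pe') mem_cat fp.
have := IH (u ++ [:: gen_of_edge e]) (p ++ q) us pe' ok1; rewrite -!catA; apply.
move: ok2; rewrite !pairwise_cat allrel_consr /=.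
by case/and3P => /andP[_ ->] -> /andP[_ ->].
Qed.

Lemma weq_xT T s : nctree T -> perm_eq s (enum T) -> pairwise (@ok n) s ->
  weq 1 (gw s) (gw (xword T)).
Proof.
move=> ncT pe oks; have [pe' ok'] := xwordP ncT.
apply: (@weq_order [::]) => //; first by rewrite (perm_uniq pe') enum_uniq.
by rewrite (perm_trans pe') // perm_sym.
Qed.

Lemma weq_edges G (u w : word n) : all (in_graph G) w ->
  exists k s, [/\ weq k (u ++ w) (u ++ gw s), {subset s <= G},
    ewt s = sigmaP w & size s = size w].
Proof.
elim: w u => [|g w IH] u /=.
  by move=> _; exists 1, [::]; split=> //; exact: weq_refl.
move=> /andP[/exists_inP[e eG E] /(IH (u ++ [:: gen_of_edge e]))].
move=> [k [s [ws sub sE sz]]]; rewrite -!catA /= in ws.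
have sub' : {subset e :: s <= G} by move=> f; rewrite inE => /orP[/eqP ->|/sub].
case/orP: E => /eqP E.
  have <- : gen_of_edge e = g by apply: val_inj.
  by exists k, (e :: s); split=> //=; rewrite ?sz // /ewt /= -/(ewt s) sE.
exists (- k), (e :: s); split=> //=; rewrite ?sz //; last first.
  by rewrite /ewt /= -/(ewt s) sE -[sval e]/(val e) E tpermC.
have := @ideal_rel n u [:: (1, [:: g]); (1, [:: gen_of_edge e])] w.
have: is_rel [:: (1, [:: g]); (1, [:: gen_of_edge e])] by left; exists g, (gen_of_edge e).
move=> H /(_ H) A; move: (idealD A (idealZ (-1) ws)); apply: ideal_ext => x.
by rewrite !big_cons big_nil /= !mul1r mulN1r; ring.
Qed.

Lemma weq_simple G (w : word n) : all (in_graph G) w -> sigmaP w = sigma_long n ->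
  size w = n.-1 -> exists k T, [/\ nctree T, T \subset G & weq k w (gw (xword T))].
Proof.
move=> wG wE wsz; have [k [s [ws sub sE sz]]] := weq_edges [::] wG.
rewrite wE in sE; rewrite wsz in sz; have [nc pe oks] := tree_of_word sE sz.
exists k, [set e in s]; split=> //.
  by apply/subsetP => e; rewrite inE => /sub.
by rewrite -[k]mulr1; apply: weq_trans ws _; apply: weq_xT.
Qed.

End TreeWords.

(** * Evaluation at rational points *)

Section Evaluation.
Variables (n : nat) (z : 'I_n -> rat).
Implicit Types (u v w : word n) (T : graph n).

Definition edge_val (p : 'I_n * 'I_n) : rat := (z p.1 - z p.2)^-1.

(* x_T |-> prod 1/(z_a - z_b) is a realization of the degree-sigma part inside
   the Orlik--Terao algebra. *)
Definition tree_val T : rat := \prod_(e in T) edge_val (val e).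

Definition full_word w : bool := (sigmaP w == sigma_long n) && (size w == n.-1).

(** The bare product does not send $x_{ij}^2$ to $0$. Keeping only words of length $n-1$ with
    product $\sigma$ repairs this without affecting tree words. *)
Definition word_val w : rat :=
  if full_word w then \prod_(g <- w) edge_val (val g) else 0.

Lemma word_val_mid u w v : word_val (u ++ w ++ v) =
  (full_word (u ++ w ++ v))%:R * (\prod_(g <- u) edge_val (val g) *
   \prod_(g <- v) edge_val (val g)) * \prod_(g <- w) edge_val (val g).
Proof.
rewrite /word_val; case: (full_word _); last by rewrite !mul0r.
by rewrite !big_cat /= mul1r -mulrA (mulrC (\prod_(g <- w) _)).
Qed.

Lemma full_word_mid u w1 w2 v : sigmaP w1 = sigmaP w2 -> size w1 = size w2 ->
  full_word (u ++ w1 ++ v) = full_word (u ++ w2 ++ v).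
Proof.
move=> E sz; rewrite /full_word !size_cat sz; congr (_ && _).
by rewrite !sigmaPE !map_cat !tprod_cat -!sigmaPE E.
Qed.

Lemma word_val_ctx u v w0 (r : fsum n) :
  (forall p, p \in r -> sigmaP p.2 = sigmaP w0 /\ size p.2 = size w0) ->
  \sum_(p <- r) p.1 * \prod_(g <- p.2) edge_val (val g) = 0 ->
  \sum_(p <- r) p.1 * word_val (u ++ p.2 ++ v) = 0.
Proof.
move=> same E0; set K := (full_word (u ++ w0 ++ v))%:R * (\prod_(g <- u)
  edge_val (val g) * \prod_(g <- v) edge_val (val g)).
rewrite -[RHS](mulr0 K) -[in RHS]E0 mulr_sumr big_seq [RHS]big_seq.
apply: eq_bigr => p /same[sp szp].
by rewrite word_val_mid (full_word_mid _ _ sp szp) -/K mulrCA.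
Qed.

(** All terms of a relation have the same length, and, squares aside, the same permutation, so it
    suffices to evaluate the relation itself; the triangle is a partial fraction identity. A square
    in a full word could be cancelled, leaving $n-3$ transpositions to produce a single cycle. *)
Lemma word_val_rel (n0 : (0 < n)%N) (inj_z : injective z) u r v : is_rel r ->
  \sum_(p <- r) p.1 * word_val (u ++ p.2 ++ v) = 0.
Proof.
have zneq x y : x != y -> z x - z y != 0 by rewrite subr_eq0 (inj_eq inj_z).
case=> [[g [h [E ->]]]|[[g ->]|[[g [h [uni ->]]]|[g1 [g2 [g3]]]]]].
- apply: (@word_val_ctx _ _ [:: g]) => [p|].
    rewrite !inE => /orP[]/eqP -> //=.
    by rewrite /sigmaP /= -[sval h]/(val h) E tpermC.
  rewrite !big_cons !big_nil /= -[sval h]/(val h) E /edge_val /=.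
  by rewrite -(opprB (z (sval g).1)) invrN; ring.
- rewrite big_seq1 /= /word_val ifF ?mulr0 //.
  apply/negP => /andP[/eqP E /eqP sz].
  have := card_porbits_tprod (map val (u ++ v)).
  have -> : tprod (map val (u ++ v)) = sigma_long n.
    rewrite -E sigmaPE !map_cat /= !tprod_cat /= -!mulgA; congr (_ * _)%g.
    by rewrite mulgA tperm2 mul1g.
  rewrite card_porbits_long // size_map size_cat.
  by move: sz; rewrite !size_cat /=; move: (size u) (size v) => *; lia.
- apply: (@word_val_ctx _ _ [:: g; h]) => [p|]; last first.
    by rewrite !big_cons !big_nil /=; ring.
  rewrite !inE => /orP[]/eqP -> //=; split=> //.
  move: uni; rewrite /= !inE !negb_or /sigmaP /= -!andbA !mul1g.
  case/and4P => _ gh1 gh2 /and4P[gh3 gh4 _ _].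
  by rewrite conjgC tpermJ !tpermD // eq_sym.
- case: g1 g2 g3 => [[a b] ab] [[b' c] bc] [[c' a'] ca] /=.
  move=> [Eb [Ec [Ea [+ ->]]]]; subst b' c' a'.
  rewrite /= !inE negb_or => /and3P[/andP[nab nac] nbc _].
  apply: (@word_val_ctx _ _ [:: exist _ (a, b) ab; exist _ (b, c) bc]) => [p|].
    rewrite !inE => /or3P[]/eqP -> //=; split=> //; rewrite /sigmaP /= !mul1g.
      rewrite (conjgC (tperm c a)) tpermJ tpermR.
      by rewrite tpermD 1?eq_sym // [tperm b a]tpermC.
    rewrite [RHS]conjgC tpermJ tpermR tpermD //.
    by rewrite [tperm a c]tpermC.
  rewrite !big_cons !big_nil /=.
  rewrite /edge_val /=.
  move: (zneq _ _ nab) (zneq _ _ nac) (zneq _ _ nbc).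
  move: (z a) (z b) (z c) => A B C h1 h2 h3.
  have h2' : C - A != 0 by rewrite -opprB oppr_eq0.
  by field; rewrite h1 h3 h2'.
Qed.

Lemma word_val_xT (n0 : (0 < n)%N) T : nctree T ->
  word_val (gw (xword T)) = tree_val T.
Proof.
move=> ncT; have [pe oks] := xwordP n0 ncT; have /andP[tT _] := ncT.
have [E sz] := ewt_order tT pe oks.
rewrite /word_val /full_word sigmaP_gw E /gw size_map sz !eqxx /= big_map.
by rewrite (perm_big _ pe) /= big_enum.
Qed.

Lemma congr_comb_val (n0 : (0 < n)%N) (inj_z : injective z) (c d : graph n -> rat) :
  (forall T, c T != 0 -> nctree T) -> (forall T, d T != 0 -> nctree T) ->
  congr (comb c) (comb d) ->
  \sum_T c T * tree_val T = \sum_T d T * tree_val T.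
Proof.
move=> ncc ncd /(evalF_congr (word_val_rel n0 inj_z)); rewrite !evalF_comb.
have E (h : graph n -> rat) : (forall T, h T != 0 -> nctree T) ->
    \sum_T h T * word_val (map (@gen_of_edge n) (xword T)) = \sum_T h T * tree_val T.
  move=> nch; apply: eq_bigr => T _; have [->|/nch ncT] := eqVneq (h T) 0.
    by rewrite !mul0r.
  by rewrite -(word_val_xT n0 ncT).
by rewrite !E.
Qed.

End Evaluation.

(** * Contraction and linear independence *)

Section Reduced.
Variable n : nat.
Implicit Types (e f : edge n) (G H T : graph n) (x y a b p q r s : 'I_n).

Definition up H : rel 'I_n := fun x y => [exists e in H, val e == (x, y)].

Lemma upP H x y : reflect (exists2 e, e \in H & val e = (x, y)) (up H x y).
Proof. exact: 'exists_in_eqP. Qed.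

Lemma up_lt H x y : up H x y -> (x < y)%N.
Proof. by case/upP => e _ E; have := edge_lt e; rewrite E. Qed.

Lemma up_edge H e : e \in H -> up H (val e).1 (val e).2.
Proof. by move=> eH; apply/upP; exists e; case: (val e). Qed.

Lemma up_sub G T x y : T \subset G -> up T x y -> up G x y.
Proof. by move=> sub /upP[e eT E]; apply/upP; exists e => //; apply: (subsetP sub). Qed.

Lemma up_mem H e x y : up H x y -> val e = (x, y) -> e \in H.
Proof. by move=> /upP[f fH F] E; rewrite (_ : e = f) //; apply: val_inj; rewrite E. Qed.

Lemma noncrossing_up H : noncrossing H <->
  forall p q r s, up H p q -> up H r s -> ~ [/\ p < r, r < q & q < s]%N.
Proof.
split=> [/noncrossingP nc p q r s /upP[e eH E] /upP[f fH F] [h1 h2 h3]|A].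
  by case/negP: (nc e f eH fH); rewrite /crossing E F; apply/and3P.
by apply/noncrossingP => e f /up_edge E /up_edge F; apply/negP => /and3P /(A _ _ _ _ E F).
Qed.

(* The edge [(p, q)], with [p = last a m], closes the forbidden cycle
   [a, m, q] of the definition of a [G]-reduced tree. *)
Definition broken G T : Prop := exists a m q,
  [/\ path (up T) a m, m != [::], up T a q, up G (last a m) q &
      forall r s, up T r s -> ~ [/\ r < last a m, last a m < s & s < q]%N /\
                              ~ [/\ last a m < r, r < q & q < s]%N].

(** Nothing is said about trees: contraction isolates a vertex, so the induction needs a class of
    edge sets larger than the spanning trees. *)
Definition reduced G T : Prop := [/\ noncrossing T, T \subset G & ~ broken G T].

Lemma broken_sub G G' T : G' \subset G -> broken G' T -> broken G T.
Proof.
move=> sub [a [m [q [pth mn aq lq nc]]]].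
by exists a, m, q; split=> //; apply: up_sub lq.
Qed.

Section Contraction.
Variables (G : graph n) (a b : 'I_n) (e0 : edge n).
Hypothesis e0E : val e0 = (a, b).
Hypothesis e0min : forall x y, up G x y -> (b < y)%N \/ y = b /\ (a <= x)%N.

Lemma ltab : (a < b)%N.
Proof. by have := edge_lt e0; rewrite e0E. Qed.

Lemma up_ab T : e0 \in T -> up T a b.
Proof. by move=> eT; apply/upP; exists e0. Qed.

(* The merged vertex is called [b]; no edge of the contraction meets [a]. *)
Definition merge e : edge n := if (val e).1 == a then insubd e (b, (val e).2) else e.

Lemma val_merge e : e \in G -> e != e0 ->
  val (merge e) = if (val e).1 == a then (b, (val e).2) else val e.
Proof.
move=> eG ne; rewrite /merge; case: eqP => // E.
rewrite val_insubd /=; suff -> : (b < (val e).2)%N by [].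
have := up_edge eG; case/e0min => // -[E2 _]; case/negP: ne.
by rewrite -val_eqE e0E /= -E -E2 -surjective_pairing.
Qed.

Definition contract H : graph n := merge @: (H :\ e0).

Lemma up_contract H x y : H \subset G -> up (contract H) x y <->
  x != a /\ (up H x y \/ [/\ x = b, up H a y & (b < y)%N]).
Proof.
move=> sub; have lt := ltab.
have ba : b != a by rewrite -val_eqE /= gtn_eqF.
split=> [/upP[g /imsetP[f]]|[xa]].
  rewrite !inE => /andP[ne fH] ->; have fG := subsetP sub f fH.
  rewrite val_merge //; case: eqP => [E [<- <-]|/eqP E F].
    split=> //; right; split=> //; first by rewrite -E up_edge.
    case: (e0min (up_edge fG)) => // -[E2 _]; case/negP: ne.
    by rewrite -val_eqE e0E /= -E -E2 -surjective_pairing.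
  by rewrite F /= in E; split=> //; left; apply/upP; exists f.
case=> [/upP[f fH F]|[Ex /upP[f fH F] by_]]; last subst x.
  have ne : f != e0 by apply: contraNneq xa => E; move: F; rewrite E e0E => -[<-].
  apply/upP; exists (merge f); first by apply: imset_f; rewrite !inE ne.
  by rewrite val_merge ?(subsetP sub) // F /= (negbTE xa).
have ne : f != e0.
  by apply: contraTneq by_ => E; move: F; rewrite E e0E => -[<-]; rewrite ltnn.
apply/upP; exists (merge f); first by apply: imset_f; rewrite !inE ne.
by rewrite val_merge ?(subsetP sub) // F /= eqxx.
Qed.

Lemma contract_sub T : T \subset G -> contract T \subset contract G.
Proof. by move=> sub; apply/imsetS/setSD. Qed.

Section Star.
Variable T : graph n.
Hypothesis redT : reduced G T.
Hypothesis e0T : e0 \in T.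

Let sub : T \subset G. Proof. by case: redT. Qed.

Let nc p q r s : up T p q -> up T r s -> (p < r)%N -> (r < q)%N -> (q < s)%N -> False.
Proof.
case: redT => /noncrossing_up H _ _ pq rs h1 h2 h3.
by apply: (H p q r s pq rs).
Qed.

Let ab : up T a b := up_ab e0T.

Lemma contract_noncrossing : noncrossing (contract T).
Proof.
have lt := ltab; apply/noncrossing_up => p q r s.
move=> /(up_contract _ _ sub)[/negP pa pq] /(up_contract _ _ sub)[/negP ra rs] [h1 h2 h3].
case: pq rs => [pq|[Ep aq bq]] [rs|[Er as_ bs]].
- exact: nc pq rs h1 h2 h3.
- subst r; case: (ltngtP p a) => [pa'|ap|/val_inj E].
  + by apply: (nc pq as_ pa') => //; apply: ltn_trans h2.
  + by apply: (nc ab pq ap).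
  + by apply: pa; rewrite E.
- by subst p; apply: (nc aq rs) => //; apply: ltn_trans h1.
- by subst p r; rewrite ltnn in h1.
Qed.

Lemma path_contract x m : (b < x)%N -> path (up (contract T)) x m ->
  path (up T) x m /\ (b < last x m)%N.
Proof.
have lt := ltab; elim: m x => [|y m IH] x bx //= /andP[xy pth].
have bE : x != b by rewrite -val_eqE /= gtn_eqF.
case: (proj1 (up_contract _ _ sub) xy) => _ [xy'|[E]]; last by rewrite E eqxx in bE.
have [-> ->] := IH y (ltn_trans bx (up_lt xy')) pth.
by rewrite xy'.
Qed.

(** A forbidden cycle of the contraction lifts to [T]. The merged vertex can only be its lowest
    vertex [x]. If the path starts from [b] and the long edge from [a], the edge [e0] is inserted;
    with the roles exchanged the two edges would cross. *)
Lemma contract_broken : ~ broken (contract G) (contract T).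
Proof.
have lt := ltab.
move=> [x [[|y m] [q [//= /andP[xy pth] _ xq lq ncq]]]].
have up1 (u v : 'I_n) : (b < u)%N -> up (contract G) u v -> up G u v.
  move=> bu /(up_contract _ _ (subxx G))[_ [//|[E]]].
  by rewrite E ltnn in bu.
have yq := up_lt lq; have leyl : (y <= last y m)%N.
  elim: m y {xy lq ncq yq} pth => [|w m IH] y //= /andP[/up_lt yw /IH].
  by apply: leq_trans; apply: ltnW.
(* The closing edge starts beyond [b], so it is an edge of [G] itself; an edge of [T] at [a] is
   tested for crossing through its image at [b]. *)
have fin c m' : (b < y)%N -> (b < last y m)%N -> path (up T) c m' -> m' != [::] ->
    last c m' = last y m -> up T c q -> False.
  move=> by_ bl pth' mn El cq; case: redT => _ _; apply; exists c, m', q.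
  rewrite El; split=> //; first exact: up1.
  move=> r s rs; have [/eqP Er|ra] := boolP (r == a); last first.
    by apply: ncq; apply/(up_contract _ _ sub); split=> //; left.
  subst r; split=> [[h1 h2 h3]|[h1 _ _]]; last first.
    by have := ltn_trans lt (ltn_trans bl h1); rewrite ltnn.
  have bs : (b < s)%N := ltn_trans bl h2.
  have [|A _] := ncq b s.
    by apply/(up_contract _ _ sub); split; [rewrite -val_eqE /= gtn_eqF|right].
  exact: A.
case/(up_contract _ _ sub): xy => xa xy; case/(up_contract _ _ sub): xq => _ xq.
have [/eqP Ex|xb] := boolP (x == b).
  subst x; have by_ : (b < y)%N by case: xy => [/up_lt|[]].
  have [pth' bl] := path_contract by_ pth.
  case: xy xq => [xy|[_ ay _]] [xq|[_ aq _]].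
  - by apply: (fin b (y :: m)) => //=; rewrite xy.
  - by apply: (fin a [:: b, y & m]) => //=; rewrite ab xy.
  - apply: (nc ay xq) => //; exact: leq_ltn_trans yq.
  - by apply: (fin a (y :: m)) => //=; rewrite ay.
case: xy => [xy|[E]]; last by rewrite E eqxx in xb.
case: xq => [xq|[E]]; last by rewrite E eqxx in xb.
(* By minimality of [e0], an edge ending at [b] and not starting at [a] starts strictly between
   them, and then the long edge to [q] would cross [e0]. *)
have by_ : (b < y)%N.
  case: (e0min (up_sub sub xy)) => // -[E ax]; subst y.
  exfalso; apply: (nc ab xq); first by rewrite ltn_neqAle eq_sym val_eqE xa.
    exact: up_lt xy.
  exact: leq_ltn_trans yq.
have [pth' bl] := path_contract by_ pth.
by apply: (fin x (y :: m)) => //=; rewrite xy.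
Qed.

Lemma contract_reduced : reduced (contract G) (contract T).
Proof.
by split; [exact: contract_noncrossing|exact: contract_sub|exact: contract_broken].
Qed.

(* Otherwise [(b, y)] would close the forbidden cycle [a, b, y]. *)
Lemma star_chord y : up T a y -> up G b y -> exists2 s, up T a s & (b < s < y)%N.
Proof.
have lt := ltab; move=> ay by_; have yb := up_lt by_.
case: redT => _ _ nb; apply: NNPP => nos; apply: nb; exists a, [:: b], y.
rewrite /= ab; split=> // r s rs; split=> [[h1 h2 h3]|[h1 h2 h3]].
  case: (ltngtP r a) => [ra|ar|/val_inj E].
  - by apply: (nc rs ay ra) => //; apply: ltn_trans h2.
  - exact: nc ab rs ar h1 h2.
  - by apply: nos; exists s; rewrite -?E // h2.
by apply: (nc ay rs) => //; apply: ltn_trans h1.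
Qed.

Lemma star_unique y : up T a y -> up T b y -> False.
Proof.
move=> ay by_; have [s as_ /andP[bs sy]] := star_chord ay (up_sub sub by_).
exact: (nc as_ by_ ltab bs sy).
Qed.

Lemma merge_inj : {in T :\ e0 &, injective merge}.
Proof.
move=> f g; rewrite !inE => /andP[nf fT] /andP[ng gT] E.
have fG := subsetP sub f fT; have gG := subsetP sub g gT.
have := congr1 val E; rewrite !val_merge // => {}E; apply: val_inj.
have uf := up_edge fT; have ug := up_edge gT.
move: E; case: eqP => Ef; case: eqP => Eg E //.
- rewrite [LHS]surjective_pairing [RHS]surjective_pairing Ef Eg.
  by rewrite (congr1 snd E : (val f).2 = (val g).2).
- case: (@star_unique (val f).2); first by rewrite -Ef.
  by rewrite -E in ug.
- case: (@star_unique (val g).2); first by rewrite -Eg.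
  by rewrite E in uf.
Qed.

End Star.

Lemma contract_inj T1 T2 : reduced G T1 -> reduced G T2 ->
  e0 \in T1 -> e0 \in T2 -> contract T1 = contract T2 -> T1 = T2.
Proof.
wlog suff W : T1 T2 / reduced G T1 -> reduced G T2 ->
  e0 \in T1 -> e0 \in T2 -> contract T1 = contract T2 -> T1 \subset T2.
  by move=> r1 r2 i1 i2 E; apply/eqP; rewrite eqEsubset !W.
have lt := ltab.
have ba : b != a by rewrite -val_eqE /= gtn_eqF.
(* Descent on [y]: in [T] there is an edge from [a] to some [s] strictly between [b] and [y]. Its
   image at [b] also comes from [T'], either from an edge at [b], a smaller conflict, or from one at
   [a], which crosses the edge from [b] to [y]. *)
have conflict : forall T T' y, reduced G T -> reduced G T' -> e0 \in T -> e0 \in T' ->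
    contract T = contract T' -> up T a y -> up T' b y -> False.
  move=> T T' y; move: {-1}(val y) (leqnn y) => k.
  elim: k y => [|k IH] y yk r r' i i' E ay by'.
    by have := leq_trans (up_lt ay) yk.
  have sub' : T' \subset G by case: r'.
  have sub : T \subset G by case: r.
  have [s as_ /andP[bs sy]] := star_chord r i ay (up_sub sub' by').
  have : up (contract T') b s.
    by rewrite -E; apply/(up_contract _ _ sub); split=> //; right.
  case/(up_contract _ _ sub') => _ [bs'|[_ as' _]].
    by apply: (IH s _ r r' i i' E as_ bs'); rewrite -ltnS; apply: leq_trans yk.
  by case: r' => /noncrossing_up nc _ _; apply: (nc _ _ _ _ as' by').
move=> r1 r2 i1 i2 E; have sub1 : T1 \subset G by case: r1.
have sub2 : T2 \subset G by case: r2.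
apply/subsetP => f fT; have uf := up_edge fT.
have Ef : val f = ((val f).1, (val f).2) by exact: surjective_pairing.
have [fa|fa] := boolP ((val f).1 == a); last first.
  have : up (contract T2) (val f).1 (val f).2.
    by rewrite -E; apply/(up_contract _ _ sub1); split=> //; left.
  case/(up_contract _ _ sub2) => _ [u2|[Eb u2 _]]; first exact: up_mem u2 Ef.
  by case: (conflict T2 T1 (val f).2) => //; rewrite -Eb.
rewrite (eqP fa) in uf Ef.
case: (e0min (up_sub sub1 uf)) => [by_|[E2 _]]; last first.
  by rewrite (_ : f = e0) //; apply: val_inj; rewrite Ef e0E E2.
have : up (contract T2) b (val f).2.
  by rewrite -E; apply/(up_contract _ _ sub1); split=> //; right.
case/(up_contract _ _ sub2) => _ [u2|[_ u2 _]]; last exact: up_mem u2 Ef.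
by case: (conflict T1 T2 (val f).2).
Qed.

End Contraction.
End Reduced.

Lemma poly_nat_roots (P : {poly rat}) : (forall k : nat, P.[k%:R] = 0) -> P = 0.
Proof.
move=> H; apply/eqP; apply: contraT => P0.
have := @max_poly_roots _ P [seq k%:R | k <- iota 0 (size P)] P0.
rewrite size_map size_iota ltnn; apply.
  by apply/allP => x /mapP[k _ ->]; apply/eqP.
by rewrite map_inj_uniq ?iota_uniq // => i j /eqP; rewrite eqr_nat => /eqP.
Qed.

(** * Residues and linear independence of the rational functions *)

Section Independence.
Variable n : nat.
Implicit Types (e f : edge n) (G H T : graph n) (z : 'I_n -> rat).

Section Residue.
Variables (G : graph n) (a b : 'I_n) (e0 : edge n) (z : 'I_n -> rat).
Hypothesis e0E : val e0 = (a, b).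
Hypothesis e0G : e0 \in G.
Hypothesis e0min : forall x y, up G x y -> (b < y)%N \/ y = b /\ (a <= x)%N.
Hypothesis z_inj : injective z.

Let at_a e := (val e).1 == a.

(* [tree_val] at [z] with [z a] replaced by the indeterminate, after clearing
   the denominators that involve it. *)
Let numer T : {poly rat} := (\prod_(f in T | ~~ at_a f) edge_val z (val f))%:P *
  \prod_(f in G :\: T | at_a f) ('X - (z (val f).2)%:P).

Let zx (x : rat) : 'I_n -> rat := fun i => if i == a then x else z i.

Lemma snd_neq e : e \in G -> (val e).2 != a.
Proof.
move=> /up_edge /e0min; have := ltab e0E; rewrite -val_eqE /=.
by move=> ab [lt|[-> _]]; rewrite gtn_eqF // (ltn_trans ab).
Qed.

Lemma numer_eval T x : T \subset G -> (forall j, x != z j) ->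
  tree_val (zx x) T * \prod_(f in G | at_a f) (x - z (val f).2) = (numer T).[x].
Proof.
move=> sub xz; rewrite /numer hornerM hornerC horner_prod.
rewrite /tree_val (bigID at_a) /= [X in X * _]mulrC -mulrA; congr (_ * _).
  apply: eq_bigr => f /andP[fT fa].
  by rewrite /edge_val /zx ifN // ifN // snd_neq ?(subsetP sub).
rewrite [X in _ * X = _](bigID (mem T)) /= mulrA [X in X * _ = _](_ : _ = 1) ?mul1r.
  apply: eq_big => [f|f _]; last by rewrite hornerXsubC.
  by rewrite inE andbAC; congr (_ && _); rewrite andbC.
rewrite [X in _ * X](eq_bigl (fun f => (f \in T) && at_a f)); last first.
  move=> f; apply/andP/andP => [[/andP[_ ->] ->]//|[fT ->]].
  by rewrite fT (subsetP sub f fT).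
rewrite -big_split big1 // => f /andP[fT fa] /=.
rewrite /edge_val /zx ifT // ifN ?snd_neq ?(subsetP sub) //.
by rewrite mulVf // subr_eq0.
Qed.

(** The cleared denominator of [e0] survives as a factor that vanishes at $z_b$. *)
Lemma numer_notin T : e0 \notin T -> (numer T).[z b] = 0.
Proof.
move=> eT; rewrite /numer hornerM horner_prod [X in _ * X](bigD1 e0) /=.
  by rewrite hornerXsubC e0E /= subrr mul0r mulr0.
by rewrite inE eT e0G /at_a e0E /= eqxx.
Qed.

(** Setting $z_a=z_b$ gives each edge at [a] the value of its merged image, and by [merge_inj] no
    two edges of [T] collapse into one factor. *)
Lemma numer_contract T : reduced G T -> e0 \in T -> (numer T).[z b] =
  tree_val z (contract a b e0 T) * \prod_(f in G :\ e0 | at_a f) (z b - z (val f).2).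
Proof.
move=> rT eT; have sub : T \subset G by case: rT.
rewrite /numer hornerM hornerC horner_prod.
rewrite /tree_val /contract (big_imset _ (merge_inj e0E e0min rT eT)) /=.
rewrite [X in _ = X * _](bigID at_a) /= [X in _ = X * _]mulrC -mulrA; congr (_ * _).
  apply: eq_big => [f|f /andP[fT fa]].
    rewrite !inE; case: eqP => [->|] //=; by rewrite /at_a e0E eqxx andbF.
  rewrite (val_merge e0E e0min) ?(subsetP sub) //; last first.
    by apply: contraNneq fa => ->; rewrite /at_a e0E.
  by move: fa; rewrite /at_a => /negbTE ->.
rewrite [X in _ = _ * X](bigID (mem T)) /= mulrA [X in _ = X * _](_ : _ = 1) ?mul1r.
  apply: eq_big => [f|f _]; last by rewrite hornerXsubC.
  rewrite !inE; case: (f =P e0) => [->|] //=; first by rewrite eT.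
  by move=> _; case: (f \in T); rewrite ?andbF ?andbT.
rewrite [X in _ * X](eq_bigl (fun f => (f \in T :\ e0) && at_a f)); last first.
  move=> f; rewrite !inE; case: (f =P e0) => //= _.
  by case fT: (f \in T); rewrite ?andbF // (subsetP sub f fT) andbT.
rewrite -big_split big1 // => f /=; rewrite !inE => /andP[/andP[ne fT] fa].
have fG := subsetP sub f fT.
rewrite (val_merge e0E e0min) // (eqP fa : (val f).1 = a) eqxx /edge_val /= mulVf //.
rewrite subr_eq0 (inj_eq z_inj); apply: contra ne => /eqP E.
by apply/eqP/val_inj; rewrite e0E [LHS]surjective_pairing (eqP fa : (val f).1 = a) E.
Qed.

Lemma residue (c : graph n -> rat) : (forall T, c T != 0 -> reduced G T) ->
  (forall z', injective z' -> \sum_T c T * tree_val z' T = 0) ->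
  \sum_(T : graph n | e0 \in T) c T * tree_val z (contract a b e0 T) = 0.
Proof.
move=> cred van; pose P := \sum_T c T *: numer T.
have P0 : P = 0.
  (* The extra factor handles the points where $x$ equals some $z_j$: there the modified assignment
     need not be injective and the hypothesis may say nothing. *)
  have Z0 : \prod_j ('X - (z j)%:P) != 0.
    by rewrite monic_neq0 // monic_prod // => j _; exact: monicXsubC.
  suff /eqP : P * \prod_j ('X - (z j)%:P) = 0.
    by rewrite mulf_eq0 (negbTE Z0) orbF => /eqP.
  apply: poly_nat_roots => k; rewrite hornerM horner_prod.
  have [/existsP[j /eqP E]|] := boolP [exists j, k%:R == z j].
    by rewrite (bigD1 j) //= hornerXsubC E subrr mul0r mulr0.
  rewrite negb_exists => /forallP nz; rewrite /P horner_sum.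
  rewrite (eq_bigr (fun T => c T * tree_val (zx k%:R) T *
    \prod_(f in G | at_a f) (k%:R - z (val f).2))).
    rewrite -mulr_suml van ?mul0r // => i j; rewrite /zx.
    case: eqP => [->|_]; case: eqP => [->|_] // E; last exact: z_inj.
      by move: (nz j); rewrite E eqxx.
    by move: (nz i); rewrite E eqxx.
  move=> T _; rewrite hornerZ; have [->|/cred[_ sub _]] := eqVneq (c T) 0.
    by rewrite !mul0r.
  by rewrite -mulrA numer_eval.
have : P.[z b] = 0 by rewrite P0 horner0.
rewrite /P horner_sum (bigID (fun T : graph n => e0 \in T)) /= [X in _ + X]big1 ?addr0; last first.
  by move=> T eT; rewrite hornerZ numer_notin ?mulr0.
rewrite (eq_bigr (fun T => c T * tree_val z (contract a b e0 T) *
    \prod_(f in G :\ e0 | at_a f) (z b - z (val f).2))); last first.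
  move=> T eT; rewrite hornerZ; have [->|/cred rT] := eqVneq (c T) 0.
    by rewrite !mul0r.
  by rewrite numer_contract // mulrA.
rewrite -mulr_suml => /eqP; rewrite mulf_eq0 => /orP[/eqP//|].
rewrite prodf_seq_eq0 => /hasP[f _ /andP[/andP[]]]; rewrite !inE => /andP[ne fG] fa.
rewrite subr_eq0 (inj_eq z_inj) => /eqP E; case/negP: ne.
by apply/eqP/val_inj; rewrite e0E [LHS]surjective_pairing (eqP fa : (val f).1 = a) E.
Qed.

End Residue.

(** Deletion and contraction: the contraction annihilates the coefficients of all sets containing
    [e0], and the remaining sets are reduced for the graph without [e0]. *)
Lemma reduced_independent G (c : graph n -> rat) :
  (forall T, c T != 0 -> reduced G T) ->
  (forall z, injective z -> \sum_T c T * tree_val z T = 0) -> forall T, c T = 0.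
Proof.
move: {-1}(#|G|) (leqnn #|G|) c => k; elim: k G => [|k IH] G Gk c cred van.
  have G0 : G = set0 by apply/eqP; rewrite -cards_eq0 -leqn0.
  have c0 T : T != set0 -> c T = 0.
    move=> T0; apply/eqP; apply: contraT => /cred[_ + _].
    by rewrite G0 subset0 (negbTE T0).
  move=> T; have [->|/c0 //] := eqVneq T set0.
  have /van : injective (fun i : 'I_n => (i : nat)%:R : rat).
    by move=> i j /eqP; rewrite eqr_nat => /eqP /val_inj.
  rewrite (bigD1 set0) //= big1; last by move=> S /c0 ->; rewrite mul0r.
  by rewrite addr0 /tree_val big_set0 mulr1.
have [G0|/set0Pn[e1 e1G]] := eqVneq G set0; first by apply: (IH G _ c cred van); rewrite G0 cards0.
(* Lexicographic order on (larger end, smaller end), since smaller ends are below [n]. *)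
pose key e := ((val e).2 * n + (val e).1)%N.
case: (@arg_minnP _ e1 (mem G) key e1G) => e0 /= e0G kmin.
have [a [b e0E]] : exists a b, val e0 = (a, b) by case: (val e0) => a b; exists a, b.
have e0min x y : up G x y -> (b < y)%N \/ y = b /\ (a <= x)%N.
  case/upP => f fG F; have := kmin f fG; rewrite /key F e0E /=.
  have := ltn_ord a; have := ltn_ord x => xn an le.
  case: (ltngtP b y) => [|yb|/val_inj E]; first by left.
    by exfalso; nia.
  by right; split=> //; move: le; rewrite E leq_add2l.
have cG : (#|contract a b e0 G| <= k)%N.
  rewrite (leq_trans (leq_imset_card _ _)) // -ltnS (leq_trans _ Gk) //.
  by rewrite (cardsD1 e0 G) e0G.
have cGD : (#|G :\ e0| <= k)%N by rewrite -ltnS (leq_trans _ Gk) // (cardsD1 e0 G) e0G.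
(* Coefficients pushed forward along contraction; by [contract_inj] each fibre contains at most one
   set with nonzero coefficient. *)
pose d (S : graph n) := \sum_(T : graph n | (e0 \in T) && (contract a b e0 T == S)) c T.
have dred S : d S != 0 -> reduced (contract a b e0 G) S.
  move=> dS; have [T /andP[/andP[eT /eqP <-] cT]] : exists T,
      ((e0 \in T) && (contract a b e0 T == S)) && (c T != 0).
    apply/existsP; apply: contraNT dS; rewrite negb_exists => /forallP H.
    rewrite /d big1 // => T HT; apply/eqP.
    by have := H T; rewrite HT negbK.
  exact: (contract_reduced e0E e0min (cred T cT) eT).
have dvan z : injective z -> \sum_S d S * tree_val z S = 0.
  move=> zi; rewrite -[RHS](residue e0E e0G e0min zi cred van).
  rewrite [RHS](partition_big (contract a b e0) predT) //=; apply: eq_bigr => S _.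
  by rewrite /d mulr_suml; apply: eq_bigr => T /andP[_ /eqP ->].
have d0 := IH _ cG d dred dvan.
have c_in T : e0 \in T -> c T = 0.
  move=> eT; apply/eqP; apply: contraT => cT; have := d0 (contract a b e0 T).
  rewrite /d (bigD1 T) ?eT ?eqxx //= big1 ?addr0 => [E|S /andP[/andP[eS /eqP E] ST]].
    by rewrite E eqxx in cT.
  apply/eqP; apply: contraT => cS; case/negP: ST; apply/eqP.
  exact: (contract_inj e0E e0min (cred _ cS) (cred _ cT) eS eT E).
apply: (IH _ cGD) => // T cT; have [nc sub nb] := cred T cT; split=> //.
  rewrite subsetD1 sub; apply/negP => eT.
  by rewrite c_in ?eqxx in cT.
by move/(broken_sub (subD1set G e0)).
Qed.

End Independence.

(** * Cycle relations and straightening *)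

Section Cycles.
Variable n : nat.
Implicit Types (e f : edge n) (G H T : graph n) (a p q x y : 'I_n) (c m : seq 'I_n).

Lemma up_has_edge H x y : up H x y = (x < y)%N && has_edge H x y.
Proof.
rewrite -adj_eset; apply/idP/andP => [xy|[lt /adjP[e eH [] E]]].
- split; first exact: up_lt xy.
  by case/upP: xy => e eH E; apply/adjP; exists e => //; left.
- by apply/upP; exists e.
- by have := edge_lt e; rewrite E /= ltnNge ltnW.
Qed.

Lemma zip_rcons_self x m q :
  zip (x :: rcons m q) (rcons m q) = rcons (zip (x :: m) m) (last x m, q).
Proof. by elim: m x => [|y m IH] x //=; rewrite -IH. Qed.

Lemma take_pred_rcons (A : Type) (s : seq A) u :
  take (size (rcons s u)).-1 (rcons s u) = s.
Proof. by rewrite size_rcons /= -cats1 take_size_cat. Qed.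

Lemma path_zip_self (r : rel 'I_n) x m :
  path r x m = all (fun u => r u.1 u.2) (zip (x :: m) m).
Proof. by elim: m x => [|y m IH] x //=; rewrite IH. Qed.

Lemma sorted_last x y m : path ltn (val x) (map val (y :: m)) ->
  (x < last y m)%N && (y <= last y m)%N.
Proof.
elim: m x y => [|w m IH] x y /=; first by rewrite andbT leqnn andbT.
move=> /andP[xy /IH/=/andP[yl wl]]; by rewrite (ltn_trans xy yl) ltnW.
Qed.

Lemma noncrossing_add T e p q : val e = (p, q) ->
  noncrossing (T :|: eset p q) <-> noncrossing T /\
  forall r s, up T r s -> ~ [/\ r < p, p < s & s < q]%N /\
                          ~ [/\ p < r, r < q & q < s]%N.
Proof.
move=> E; have -> : eset p q = [set e] by apply: eset1; rewrite esetE E eqxx.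
split=> [nc|[/noncrossingP nc A]].
  split=> [|r s /upP[f fT F]].
    by move/noncrossingP: nc => nc; apply/noncrossingP => f g fT gT; apply: nc; rewrite inE ?fT ?gT.
  move/noncrossingP: nc => nc.
  have eI : e \in T :|: [set e] by rewrite !inE eqxx orbT.
  have fI : f \in T :|: [set e] by rewrite !inE fT.
  have := nc e f eI fI; have := nc f e fI eI; rewrite /crossing E F => /negP h1 /negP h2.
  by split=> -[? ? ?]; [apply: h1|apply: h2]; apply/and3P.
apply/noncrossingP => f g; rewrite !inE => /orP[fT|/eqP ->] /orP[gT|/eqP ->].
- exact: nc.
- apply/negP; rewrite /crossing E => /and3P h.
  by case: (A _ _ (up_edge fT)) => h1 _; apply: h1; case: h.
- apply/negP; rewrite /crossing E => /and3P h.
  by case: (A _ _ (up_edge gT)) => _ h1; apply: h1; case: h.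
- by rewrite /crossing ltnn.
Qed.

(** The vertex list of the definition is written [a :: rcons m q], with [q] $=i_m$ and [last a m]
    $=i_{m-1}$; dropping the last consecutive pair leaves the path through [m]. *)
Lemma G_reducedE G T : G_reduced G T <-> nctree T /\ reduced G T.
Proof.
split=> [[ncT sub nc]|[ncT [nc sub nb]]]; split=> //.
- split=> //; first by case/andP: ncT.
  move=> [a [m [q [pth mn aq lq xq]]]]; apply: nc; exists a, (rcons m q).
  have lm : (last a m < q)%N := up_lt lq.
  cbv zeta; rewrite zip_rcons_self take_pred_rcons !last_rcons size_rcons.
  split.
  + rewrite ltnS lt0n size_eq0 mn andbT /= map_rcons rcons_path last_map.
    apply/andP; split; last exact: lm.
    by rewrite path_map; apply: sub_path pth => u v; exact: up_lt.
  + by move: aq; rewrite up_has_edge => /andP[].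
  + rewrite path_zip_self in pth; apply: sub_all pth => u.
    by rewrite up_has_edge => /andP[].
  + by move: lq; rewrite up_has_edge => /andP[].
  + case/upP: lq => e _ E; apply/(noncrossing_add T E); split=> //.
    by case/andP: ncT.
- move=> [a [c]]; case/lastP: c => [|m q]; first by case=> /andP[].
  cbv zeta; rewrite zip_rcons_self take_pred_rcons !last_rcons size_rcons.
  move=> [+ aq all_T lG nc'].
  rewrite ltnS lt0n size_eq0 /= map_rcons => /andP[srt mn].
  move: (srt); rewrite rcons_path last_map => /andP[srt' lq].
  have lq' : (last a m < q)%N by exact: lq.
  have aq' : (a < q)%N.
    move: srt; rewrite -map_rcons; case: m mn {all_T lG nc' srt' lq lq'} => // y m _.
    by rewrite rcons_cons => /sorted_last; rewrite last_rcons => /andP[].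
  apply: nb; exists a, m, q; split=> //.
  + rewrite path_zip_self; move: srt'; rewrite path_map path_zip_self => lt_m.
    apply/allP => u um; rewrite up_has_edge (allP all_T u um) andbT.
    exact: (allP lt_m u um).
  + by rewrite up_has_edge aq'.
  + by rewrite up_has_edge lq'.
  + have /upP[e _ E] : up G (last a m) q by rewrite up_has_edge lq'.
    by case/(noncrossing_add T E): nc'.
Qed.

End Cycles.

(** * The cycle relations, their weights and their telescoping sums *)

Section CycleRelations.
Variable n : nat.
Implicit Types (e f : edge n) (G H T : graph n) (a p q x y : 'I_n) (c m : seq 'I_n).

Lemma cycle_edge G H a c j : cycdata G H a c -> (j <= size c)%N ->
  exists f, [/\ f \in cyc_edges (a :: c), f \in H, Tj H a c j = H :\ f &
    val f = if j == 0%N then (a, last a c)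
            else (nth a (a :: c) j.-1, nth a (a :: c) j)].
Proof.
move=> [/andP[srt sz] sub _ cyc _] jc.
set u := if j == 0%N then _ else _.
have lt : (u.1 < u.2)%N.
  rewrite /u; case: j jc {u} => [|j] jc /=.
    by case: c srt sz {sub cyc jc} => // y c /sorted_last/andP[].
  move: srt; rewrite sorted_map => /(sortedP a)/(_ j); apply.
  by rewrite /= ltnS.
have uz : (u \in zip (a :: c) (rot 1 (a :: c))) ||
          ((u.2, u.1) \in zip (a :: c) (rot 1 (a :: c))).
  rewrite rot1_cons /u; case: j jc {u lt} => [|j] jc /=; apply/orP; [right|left].
    apply/(nthP (a, a)); exists (size c); first by rewrite size_zip /= size_rcons minnn.
    by rewrite nth_zip ?size_rcons //= nth_rcons ltnn eqxx (last_nth a).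
  apply/(nthP (a, a)); exists j; first by rewrite size_zip /= size_rcons minnn ltnS ltnW.
  by rewrite nth_zip ?size_rcons //= nth_rcons jc.
have hu : has_edge H u.1 u.2.
  case/and3P: cyc => _ _; rewrite cycle_zip => /allP adjL; rewrite -adj_eset.
  by case/orP: uz => /adjL //=; rewrite adj_sym.
have /upP[f fH F] : up H u.1 u.2 by rewrite up_has_edge lt.
exists f; split=> //; last by rewrite F -surjective_pairing.
- case/orP: uz => uz; apply/cyc_edgesP; [exists u|exists (u.2, u.1)] => //;
    by rewrite esetE F eqxx ?orbT.
- suff -> : [set f] = eset u.1 u.2 by rewrite /Tj /u; case: (j == 0%N).
  by symmetry; apply: eset1; rewrite esetE F eqxx.
Qed.

Lemma cycle_tree G H a c j : cycdata G H a c -> (j <= size c)%N ->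
  nctree (Tj H a c j) && (Tj H a c j \subset G).
Proof.
move=> cd jc; have [f [fL fH -> _]] := cycle_edge cd jc.
case: cd => _ sub /andP[cH /noncrossingP ncH] cyc uni.
rewrite (subset_trans _ sub) ?subD1set // andbT /nctree (tree_of_cycle cH cyc uni fL) /=.
by apply/noncrossingP => e g; rewrite !inE => /andP[_ eH] /andP[_ gH]; apply: ncH.
Qed.

(** The key that selects the contracted edge. On an increasing cycle the edge $i_{m-1}i_m$, the one
    missing from $T_m$, is the heaviest. *)
Definition edge_weight e : nat := ((val e).2 * n + (val e).1)%N.
Definition weight T : nat := \sum_(e in T) edge_weight e.

Lemma weight_max T : (weight T <= weight setT)%N.
Proof.
rewrite {2}/weight (bigID (mem T)) /= (eq_bigl (mem T)) => [|e]; last by rewrite inE.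
exact: leq_addr.
Qed.

Lemma weight_lt G H a c j : cycdata G H a c -> (j < size c)%N ->
  (weight (Tj H a c (size c)) < weight (Tj H a c j))%N.
Proof.
move=> cd jc; have [f [_ fH -> F]] := cycle_edge cd (ltnW jc).
have [g [_ gH -> E]] := cycle_edge cd (leqnn _).
have W e : e \in H -> weight H = (edge_weight e + weight (H :\ e))%N.
  move=> eH; rewrite /weight (bigD1 e) //=; congr (_ + _)%N; apply: eq_bigl => h.
  by rewrite !inE andbC.
suff : (edge_weight f < edge_weight g)%N by have := W f fH; have := W g gH; lia.
case: cd => /andP[srt sz] _ _ _ _; rewrite /edge_weight {}F {}E {fH gH W}.
rewrite (gtn_eqF (ltn_trans _ sz)) //=.
have inc i k : (i < k <= size c)%N -> (nth a (a :: c) i < nth a (a :: c) k)%N.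
  move=> /andP[ik kc]; move: srt; rewrite sorted_map => srt.
  apply: (@sorted_ltn_nth _ (relpre val ltn) _ a (a :: c)) => //.
  - by move=> ? ? ?; apply: ltn_trans.
  - by rewrite inE /= ltnS (leq_trans _ kc) // ltnW.
have a_n (x : 'I_n) := ltn_ord x.
have [j0|j0] := posnP j.
  rewrite /= (last_nth a) ltn_add2l.
  have := inc 0%N (size c).-1; rewrite /=; apply; lia.
rewrite /=.
have h1 := inc j (size c); rewrite jc leqnn in h1.
have := a_n (nth a (a :: c) j.-1); have := h1 isT.
by move: (nth a _ _) (nth a _ _) (nth a _ _) => x y w /=; nia.
Qed.

Lemma rho_sum H a c (g : graph n -> rat) : \sum_T rho H a c T * g T =
  g (Tj H a c (size c)) - g (Tj H a c 0) + \sum_(1 <= j < size c) g (Tj H a c j).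
Proof.
have ind S : \sum_T (T == S)%:R * g T = g S.
  rewrite (bigD1 S) //= eqxx mul1r big1 ?addr0 // => T /negbTE ->.
  by rewrite mul0r.
under eq_bigr => T _ do rewrite /rho mulrDl mulrBl mulr_suml.
rewrite big_split sumrB !ind /= exchange_big /=; congr (_ + _).
by apply: eq_bigr => j _; rewrite ind.
Qed.

Lemma rho_last G H a c : cycdata G H a c -> rho H a c (Tj H a c (size c)) = 1.
Proof.
move=> cd; have ne j : (j < size c)%N -> (Tj H a c (size c) == Tj H a c j) = false.
  move=> jc; apply/negbTE/eqP => E.
  by have := weight_lt cd jc; rewrite E ltnn.
have sz : (0 < size c)%N by case: cd => /andP[_ /ltnW].
rewrite /rho eqxx ne // subr0 big_nat big1 ?addr0 // => j /andP[_ jc].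
by rewrite ne.
Qed.

Lemma rho_neq0 H a c T : rho H a c T != 0 ->
  exists2 j, (j <= size c)%N & T = Tj H a c j.
Proof.
move=> r; apply: NNPP => no; case/negP: r; apply/eqP.
have ne j : (j <= size c)%N -> (T == Tj H a c j) = false.
  by move=> jc; apply/negP => /eqP E; apply: no; exists j.
rewrite /rho !ne // subr0 add0r big_nat big1 // => j /andP[_ jc].
by rewrite ne // ltnW.
Qed.

Lemma rho_supp G H a c T : cycdata G H a c -> rho H a c T != 0 ->
  nctree T && (T \subset G).
Proof. by move=> cd /rho_neq0[j jc ->]; apply: cycle_tree. Qed.

Lemma rho_val G H a c (z : 'I_n -> rat) : injective z -> cycdata G H a c ->
  \sum_T rho H a c T * tree_val z T = 0.
Proof.
move=> zi cd; rewrite rho_sum.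
(* Deleting an edge multiplies the value of [H] by the corresponding difference of coordinates, so
   the sum telescopes after this common factor is taken out. *)
have D f : f \in H -> tree_val z (H :\ f) = tree_val z H * (z (val f).1 - z (val f).2).
  move=> fH; rewrite /tree_val [in RHS](bigD1 f) //= mulrAC /edge_val mulVf ?mul1r.
    by apply: eq_bigl => e; rewrite !inE andbC.
  by rewrite subr_eq0 (inj_eq zi) edge_neq.
have Vj j : (0 < j <= size c)%N -> tree_val z (Tj H a c j) =
    tree_val z H * (z (nth a (a :: c) j.-1) - z (nth a (a :: c) j)).
  move=> /andP[j0 jc]; have [f [_ fH -> F]] := cycle_edge cd jc.
  by rewrite D // F gtn_eqF.
have -> : tree_val z (Tj H a c 0) = tree_val z H * (z a - z (last a c)).
  by have [f [_ fH -> F]] := cycle_edge cd (leq0n _); rewrite D // F.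
have sz : (0 < size c)%N by case: cd => /andP[_ /ltnW].
rewrite Vj ?sz ?leqnn // big_nat (eq_bigr (fun j => tree_val z H *
   (z (nth a (a :: c) j.-1) - z (nth a (a :: c) j)))); last first.
  by move=> j /andP[j1 jc]; rewrite Vj // j1 ltnW.
rewrite -big_nat -mulr_sumr -!mulrBr -mulrDr.
have tel k : (0 < k)%N -> \sum_(1 <= j < k) (z (nth a (a :: c) j.-1) - z (nth a (a :: c) j)) =
    z a - z (nth a (a :: c) k.-1).
  case: k => // k _; elim: k => [|k IH]; first by rewrite big_geq //= subrr.
  by rewrite big_nat_recr //= IH /=; ring.
rewrite tel // (last_nth a); apply/eqP; rewrite mulf_eq0; apply/orP; right.
by apply/eqP; ring.
Qed.

Lemma step_exists G T : (0 < n)%N -> nctree T -> T \subset G -> ~ G_reduced G T ->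
  exists H a c, cycdata G H a c /\ Tj H a c (size c) = T.
Proof.
move=> n0 ncT sub /G_reducedE nr; case/andP: (ncT) => tT nc.
have [a [m [q [pth mn aq lq xq]]]] : broken G T.
  by apply: NNPP => nb; apply: nr; split.
have /upP[e eG E] := lq; pose H := e |: T.
have lmq := up_lt lq.
have edE : eset (last a m) q = [set e] by apply: eset1; rewrite esetE E eqxx.
have srt : sorted ltn (map val (a :: rcons m q)).
  rewrite /= map_rcons rcons_path last_map; apply/andP; split; last exact: lmq.
  by rewrite path_map; apply: sub_path pth => u v; exact: up_lt.
have adjU (S : graph n) u v : up S u v -> adj S u v by rewrite up_has_edge -adj_eset => /andP[].
have cycH (S : graph n) : T \subset S -> e \in S -> is_cyc S (a :: rcons m q).
  move=> TS eS; rewrite /is_cyc /= size_rcons !ltnS lt0n size_eq0 mn /=.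
  apply/andP; split.
    have := sorted_uniq ltn_trans ltnn srt; rewrite (map_inj_uniq val_inj) //.
  rewrite !rcons_path last_rcons; apply/andP; split; last first.
    by rewrite adj_sym; apply/adjU/(up_sub TS).
  apply/andP; split; last by apply/adjU/upP; exists e.
  by apply: sub_path pth => u v uv; apply/adjU/(up_sub TS).
have eT : e \notin T by apply/negP => eT; have := tree_acyclic (a :: rcons m q) tT; rewrite cycH.
have cyc : is_cyc H (a :: rcons m q) by apply: cycH; rewrite ?subsetUr ?setU11.
have TH : T \subset H by exact: subsetUr.
have cH : connected H by apply: connected_sub TH _; case/andP: tT.
(* The edge count makes the cycle closed by [e] the only one, as [cycdata] demands. *)
have card : #|H| = n.
  rewrite /H cardsU1 eT; case/andP: tT => _ /eqP ->.
  by rewrite /= add1n prednK.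
exists H, a, (rcons m q); split; last first.
  rewrite /Tj size_rcons /= -rcons_cons nth_rcons /= ltnS leqnn.
  rewrite -[nth a (a :: m) _](last_nth a) nth_rcons ltnn eqxx edE.
  apply/setP => f; rewrite !inE; case: eqP => [->|] //=; exact/esym/negbTE.
split=> //.
- by rewrite srt size_rcons ltnS lt0n size_eq0.
- by rewrite subUset sub1set eG.
- rewrite cH /=; have /(noncrossing_add T E) : noncrossing T /\ _ := conj nc xq.
  by rewrite edE setUC.
- by move=> L cycL; apply: (unique_cycle cH).
Qed.

End CycleRelations.

(** * Straightening over the complete graph *)

Section Straightening.
Variable n : nat.
Hypothesis n0 : (0 < n)%N.
Implicit Types (e f : edge n) (G H S T : graph n) (c d : graph n -> rat).

Definition cword T : word n := gw (xword T).

Lemma coeff_combE c w : coeff (comb c) w = \sum_T c T * (cword T == w)%:R.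
Proof. by rewrite coeff_comb; apply: eq_bigr => T _; rewrite coeff_mono. Qed.

Lemma congr_combE c d : congr (comb c) (comb d) <->
  ideal_coeff (fun w => \sum_T (c T - d T) * (cword T == w)%:R).
Proof.
rewrite congrE; split; apply: ideal_ext => w; rewrite !coeff_combE -sumrB;
  by apply: eq_bigr => T _; rewrite mulrBl.
Qed.

(** With $x_{ac}$ and $x_{ab}$ adjacent, the three-term relation reads
    $x_{ac}x_{ab}=x_{ab}x_{bc}-x_{bc}x_{ac}$. The new edge $bc$ outweighs both edges that it
    replaces. *)
Lemma triangle T (a b c : 'I_n) : nctree T -> up T a b -> up T a c -> (b < c)%N ->
  (forall x, up T a x -> ~~ (b < x < c)%N) ->
  exists T1 T2, [/\ nctree T1 /\ (weight T < weight T1)%N,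
    nctree T2 /\ (weight T < weight T2)%N &
    ideal_coeff (fun w => (cword T == w)%:R - (cword T1 == w)%:R + (cword T2 == w)%:R)].
Proof.
move=> ncT /upP[eb bT Eb] /upP[ec cT Ec] bc adjac.
have adj' f (x : 'I_n) : f \in T -> val f = (a, x) -> ~~ (b < x < c)%N.
  by move=> fT F; apply: adjac; apply/upP; exists f.
have [u [v [pe oks]]] := adjacent_order_ex n0 ncT bT cT Eb Ec bc adj'.
have ab : (a < b)%N by have := edge_lt eb; rewrite Eb.
have ac : (a < c)%N := ltn_trans ab bc.
pose ed : edge n := exist _ (b, c) bc.
have /andP[tT _] := ncT; have [sE sz] := ewt_order tT pe oks.
have nab : a != b by rewrite -val_eqE /= ltn_eqF.
have nbc : b != c by rewrite -val_eqE /= ltn_eqF.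
have nac : a != c by rewrite -val_eqE /= ltn_eqF.
have mid x y x' y' : ewt [:: x; y] = ewt [:: x'; y'] ->
    ewt (u ++ [:: x, y & v]) = ewt (u ++ [:: x', y' & v]).
  have H p q : ewt (u ++ [:: p, q & v]) =
      (tprod (map val v) * ewt [:: p; q] * tprod (map val u))%g.
    by rewrite /ewt !map_cat !tprod_cat /= !mul1g !mulgA.
  by rewrite !H => ->.
(* The two new words still have product $\sigma$ and length $n-1$, so [tree_of_word] makes them
   words of noncrossing trees with no inspection of crossings. *)
have sE1 : ewt (u ++ [:: eb, ed & v]) = sigma_long n.
  rewrite -sE; apply: mid; rewrite /ewt /= -[sval eb]/(val eb) -[sval ec]/(val ec) Eb Ec /=.
  by rewrite !mul1g conjgC tpermJ tpermR tpermD.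
have sE2 : ewt (u ++ [:: ed, ec & v]) = sigma_long n.
  rewrite -sE1; apply: mid; rewrite /ewt /= -[sval eb]/(val eb) -[sval ec]/(val ec) Eb Ec /=.
  rewrite !mul1g conjgC tpermJ tpermR.
  by rewrite (@tpermD _ b c a) 1?eq_sym // [tperm b a]tpermC.
have [|nc1 pe1 ok1] := tree_of_word sE1; first by rewrite -sz !size_cat.
have [|nc2 pe2 ok2] := tree_of_word sE2; first by rewrite -sz !size_cat.
set T1 := [set e in _] in nc1 pe1; set T2 := [set e in _] in nc2 pe2.
have wE S s : perm_eq s (enum S) -> weight S = (\sum_(e <- s) edge_weight e)%N.
  by move=> p; rewrite (perm_big _ p) /= big_enum.
have kd : (edge_weight eb < edge_weight ed)%N /\ (edge_weight ec < edge_weight ed)%N.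
  rewrite /edge_weight Eb Ec /=; have := ltn_ord a; have := ltn_ord b; have := ltn_ord c.
  by move: (ab) (bc); clear; move: (a : nat) (b : nat) (c : nat) => x y w *; split; nia.
exists T1, T2; split.
- split=> //; rewrite (wE _ _ pe) (wE _ _ pe1) !big_cat !big_cons /=.
  by rewrite ltn_add2l addnCA ltn_add2l ltn_add2r; case: kd.
- split=> //; rewrite (wE _ _ pe) (wE _ _ pe2) !big_cat !big_cons /=.
  by rewrite ltn_add2l [X in (_ < X)%N]addnCA ltn_add2l ltn_add2r; case: kd.
pose g3 : gen n := exist _ (c, a) (introN eqP (fun E : c = a => elimN eqP nac (esym E))).
have R := @ideal_rel n (gw u) [:: (1, [:: gen_of_edge eb; gen_of_edge ed]);
  (1, [:: gen_of_edge ed; g3]); (1, [:: g3; gen_of_edge eb])] (gw v).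
have R1 := @ideal_rel n (gw u ++ [:: gen_of_edge ed])
  [:: (1, [:: gen_of_edge ec]); (1, [:: g3])] (gw v).
have R2 := @ideal_rel n (gw u)
  [:: (1, [:: gen_of_edge ec]); (1, [:: g3])] (gen_of_edge eb :: gw v).
have flip : is_rel [:: (1, [:: gen_of_edge ec]); (1, [:: g3])].
  by left; exists (gen_of_edge ec), g3; split=> //=; rewrite -[sval ec]/(val ec) Ec.
have tri : is_rel [:: (1, [:: gen_of_edge eb; gen_of_edge ed]);
  (1, [:: gen_of_edge ed; g3]); (1, [:: g3; gen_of_edge eb])].
  right; right; right; exists (gen_of_edge eb), (gen_of_edge ed), g3 => /=.
  rewrite -[sval eb]/(val eb) Eb /=; split=> //; split=> //; split=> //; split=> //.
  by rewrite !inE negb_or nab nac nbc.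
have W := weq_xT n0 ncT pe oks; have W1 := weq_xT n0 nc1 pe1 ok1.
have W2 := weq_xT n0 nc2 pe2 ok2.
have A := idealD (idealD (R1 flip) (R2 flip)) (idealZ (-1) (R tri)).
have B := idealD (idealD (idealZ (-1) W) W1) (idealZ (-1) W2).
refine (@ideal_ext n _ _ _ (idealD A B)) => w.
rewrite !big_cons !big_nil /= /cword /gw !map_cat /= -!catA /=.
by ring.
Qed.

(** Of a forbidden cycle only two edges going up from its lowest vertex are used. Replacing the
    upper one by the next neighbour of [a] above [b] makes them consecutive, and the weight
    grows. *)
Lemma straighten T : nctree T -> exists d,
  (forall S, d S != 0 -> nctree S /\ reduced setT S) /\
  ideal_coeff (fun w => (cword T == w)%:R - \sum_S d S * (cword S == w)%:R).
Proof.
have [k] := ubnP (@weight n setT - weight T)%N.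
elim: k T => // k IH T lek ncT.
have [r|nr] := classic (reduced setT T).
  exists (fun S => (S == T)%:R); split=> [S|].
    by have [->|_] := eqVneq S T; rewrite ?eqxx.
  apply: ideal_ext (ideal0 n) => w; rewrite (bigD1 T) //= eqxx mul1r.
  rewrite big1 ?addr0 ?subrr // => S /negbTE ->; exact: mul0r.
have [a [m [q [pth mn aq lq _]]]] : broken setT T.
  by apply: NNPP => nb; apply: nr; split; rewrite ?subsetT //; case/andP: ncT.
have [b [ab bq]] : exists b, up T a b /\ (b < q)%N.
  case: m mn pth lq => // b m _ /= /andP[ab pth] /up_lt lq; exists b; split=> //.
  have : path ltn (val a) (map val (b :: m)).
    rewrite path_map; apply/andP; split; first exact: (up_lt ab).
    by apply: sub_path pth => x y; exact: up_lt.
  by move=> /sorted_last/andP[_ bl]; apply: leq_ltn_trans bl lq.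
have [c /andP[ac bc] cmin] := @arg_minnP _ q (fun x => up T a x && (b < x)%N) val
  (introT andP (conj aq bq)).
have [T1 [T2 [[nc1 w1] [nc2 w2] I]]] : exists T1 T2,
    [/\ nctree T1 /\ (weight T < weight T1)%N,
    nctree T2 /\ (weight T < weight T2)%N &
    ideal_coeff (fun w => (cword T == w)%:R - (cword T1 == w)%:R + (cword T2 == w)%:R)].
  apply: (triangle ncT ab ac bc) => d ad; apply/negP => /andP[bd dc].
  by have := cmin d; rewrite ad bd => /(_ isT); rewrite leqNgt dc.
have lt S : (weight T < weight S)%N -> (@weight n setT - weight S < k)%N.
  by have := weight_max S; have := weight_max T; lia.
have [d1 [s1 I1]] := IH T1 (lt _ w1) nc1; have [d2 [s2 I2]] := IH T2 (lt _ w2) nc2.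
exists (fun S => d1 S - d2 S); split=> [S|].
  have [E|/s1 //] := eqVneq (d1 S) 0; rewrite E sub0r oppr_eq0; exact: s2.
apply: ideal_ext (idealD I (idealD I1 (idealZ (-1) I2))) => w.
under [in RHS]eq_bigr => S _ do rewrite mulrBl.
by rewrite sumrB; ring.
Qed.

(** Rational functions detect every relation among noncrossing trees, with no reference to $G$;
    relations of $G$ whose straightening passes through edges outside $G$ are covered too. *)
Lemma comb_ideal_val c : (forall T, c T != 0 -> nctree T) ->
  ideal_coeff (fun w => \sum_T c T * (cword T == w)%:R) <->
  (forall z : 'I_n -> rat, injective z -> \sum_T c T * tree_val z T = 0).
Proof.
move=> ncc; split=> [I z zi|van].
  have c0 T : (fun=> 0 : rat) T != 0 -> nctree T by rewrite eqxx.
  rewrite (congr_comb_val n0 zi ncc c0); last first.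
    by apply/congr_combE; apply: ideal_ext I => w; apply: eq_bigr => T _; rewrite subr0.
  by rewrite big1 // => T _; rewrite mul0r.
have ex T : exists d, nctree T -> (forall S, d S != 0 -> nctree S /\ reduced setT S) /\
  ideal_coeff (fun w => (cword T == w)%:R - \sum_S d S * (cword S == w)%:R).
  have [ncT|nc] := boolP (nctree T); last by exists (fun=> 0).
  by have [d H] := straighten ncT; exists d.
(* [h] is the straightened form of [c]. It has the same evaluations, all zero, so independence over
   the complete graph forces it to vanish. *)
have [d dP] := fin_all_exists ex; pose h S := \sum_T c T * d T S.
have hsupp S : h S != 0 -> nctree S /\ reduced setT S.
  move=> hS; apply: NNPP => no; case/negP: hS; apply/eqP/big1 => T _.
  have [->|/ncc /dP[sd _]] := eqVneq (c T) 0; first by rewrite mul0r.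
  have [->|/sd //] := eqVneq (d T S) 0; exact: mulr0.
have I : ideal_coeff (fun w => \sum_T (c T - h T) * (cword T == w)%:R).
  have A : ideal_coeff (fun w => \sum_T c T *
      ((cword T == w)%:R - \sum_S d T S * (cword S == w)%:R)).
    apply: ideal_sum => T _; have [->|/ncc /dP[_ +]] := eqVneq (c T) 0.
      by apply: ideal_ext (ideal0 n) => w; rewrite mul0r.
    exact: idealZ.
  apply: ideal_ext A => w.
  under [in LHS]eq_bigr => T _ do rewrite mulrBr.
  under [in RHS]eq_bigr => T _ do rewrite mulrBl.
  rewrite !sumrB; congr (_ - _).
  under [in RHS]eq_bigr => S _ do rewrite /h mulr_suml.
  rewrite exchange_big /=; apply: eq_bigr => T _; rewrite mulr_sumr.
  by apply: eq_bigr => S _; rewrite mulrA.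
have h0 : forall T, h T = 0.
  apply: (@reduced_independent n setT) => [T /hsupp[]//|z zi].
  have hnc T : h T != 0 -> nctree T by case/hsupp.
  rewrite -(@congr_comb_val _ _ n0 zi c h ncc hnc); first exact: van.
  exact/congr_combE.
by apply: ideal_ext I => w; apply: eq_bigr => T _; rewrite h0 subr0.
Qed.

End Straightening.

(** * Rewriting *)

Section Rewriting.
Variables (n : nat) (G : graph n).
Hypothesis n0 : (0 < n)%N.
Implicit Types (T : graph n) (c v : graph n -> rat) (f : fsum n).

Definition supported v : Prop := forall T, v T != 0 -> nctree T && (T \subset G).

Lemma supported_nctree v : supported v -> forall T, v T != 0 -> nctree T.
Proof. by move=> vs T /vs /andP[]. Qed.

Lemma congr_comb0 c : congr (comb c) [::] <->
  ideal_coeff (fun w => \sum_T c T * (cword T == w)%:R).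
Proof.
by rewrite congrE; split; apply: ideal_ext => w; rewrite coeff_nil subr0 coeff_combE.
Qed.

Lemma congr_trans (f g h : fsum n) : congr f g -> congr g h -> congr f h.
Proof.
rewrite !congrE => A B; apply: ideal_ext (idealD A B) => w.
by rewrite addrA subrK.
Qed.

Lemma congr_sym (f g : fsum n) : congr f g -> congr g f.
Proof.
rewrite !congrE => /(idealZ (-1)); apply: ideal_ext => w.
by rewrite mulN1r opprB.
Qed.

Lemma congr_refl f : congr f f.
Proof. by apply/congrE; apply: ideal_ext (ideal0 n) => w; rewrite subrr. Qed.

Lemma G_reduced_independent c : (forall T, c T != 0 -> G_reduced G T) ->
  congr (comb c) [::] -> forall T, c T = 0.
Proof.
move=> cr /congr_comb0 I; apply: (@reduced_independent n G).
  by move=> T /cr /G_reducedE[].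
by apply/(comb_ideal_val n0) => // T /cr /G_reducedE[].
Qed.

Lemma rho_ideal H a (s : seq 'I_n) : cycdata G H a s ->
  ideal_coeff (fun w => \sum_T rho H a s T * (cword T == w)%:R).
Proof.
move=> cd; apply/(comb_ideal_val n0) => [T /(rho_supp cd)/andP[]//|z zi].
exact: rho_val cd.
Qed.

Lemma step_supported v v' : supported v -> step G v v' -> supported v'.
Proof.
move=> vs [H [a [s [cd _ E]]]] T; have [/vs //|/negPn/eqP v0] := boolP (v T != 0).
rewrite E v0 sub0r oppr_eq0 mulf_eq0 negb_or => /andP[_].
exact: rho_supp cd.
Qed.

Lemma step_congr v v' : step G v v' -> congr (comb v') (comb v).
Proof.
move=> [H [a [s [cd _ E]]]]; apply/congr_combE.
apply: ideal_ext (idealZ (- v (Tj H a s (size s))) (rho_ideal cd)) => w.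
by rewrite mulr_sumr; apply: eq_bigr => T _; rewrite E; ring.
Qed.

Lemma steps_inv v v' : clos_refl_trans _ (step G) v v' -> supported v ->
  supported v' /\ congr (comb v') (comb v).
Proof.
elim=> [x y xy xs|x xs|x y w _ IH1 _ IH2 xs].
- by split; [exact: step_supported xy|exact: step_congr].
- by split=> //; exact: congr_refl.
- have [ys xy] := IH1 xs; have [ws yw] := IH2 ys; split=> //.
  exact: congr_trans yw xy.
Qed.

(** A rewriting sequence is its own certificate: it records the multiples of cycle relations that
    were subtracted. A combination that vanishes in the algebra rewrites to $0$, so it is the sum of
    these multiples. *)
Lemma steps_rho v v' : clos_refl_trans _ (step G) v v' ->
  exists s : seq (rat * (graph n * ('I_n * seq 'I_n))),
    (forall t, t \in s -> cycdata G t.2.1 t.2.2.1 t.2.2.2) /\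
    forall T, v T = v' T + \sum_(t <- s) t.1 * rho t.2.1 t.2.2.1 t.2.2.2 T.
Proof.
elim=> [x y [H [a [s [cd _ E]]]]|x|x y w _ [s1 [c1 E1]] _ [s2 [c2 E2]]].
- exists [:: (x (Tj H a s (size s)), (H, (a, s)))]; split=> [t|T].
    by rewrite inE => /eqP ->.
  by rewrite big_seq1 E subrK.
- by exists [::]; split=> // T; rewrite big_nil addr0.
- exists (s1 ++ s2); split=> [t|T]; first by rewrite mem_cat => /orP[/c1|/c2].
  by rewrite big_cat /= E1 E2 -addrA [X in _ + X]addrC.
Qed.

(* A step trades the tree [T_m] for trees of larger weight, so this number
   strictly decreases. *)
Definition potential v : nat :=
  \sum_(T : graph n | v T != 0%R) #|{: graph n}|.+1 ^ (@weight n setT - weight T).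

Lemma step_potential v v' : step G v v' -> (potential v' < potential v)%N.
Proof.
move=> [H [a [s [cd nz E]]]]; set M := Tj H a s (size s) in nz E.
set B := #|{: graph n}|.+1; pose w T := (B ^ (@weight n setT - weight T))%N.
have v'M : v' M = 0 by rewrite E (rho_last cd) mulr1 subrr.
have bigger T : v T == 0 -> v' T != 0 -> (weight M < weight T)%N.
  move=> /eqP v0 v'T.
  have TM : T != M by apply: contraNneq v'T => ->; rewrite v'M.
  move: v'T; rewrite E v0 sub0r oppr_eq0 mulf_eq0 negb_or => /andP[_ /rho_neq0[j jc TE]].
  rewrite TE; apply: weight_lt cd _; rewrite ltn_neqAle jc andbT.
  by apply: contraNneq TM => jE; rewrite TE jE.
rewrite /potential [X in (_ < X)%N](bigD1 M) //=.
apply: (@leq_ltn_trans (\sum_(T : graph n | (weight M < weight T)%N) w T +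
    \sum_(T | (v T != 0%R) && (T != M)) w T)%N).
  rewrite big_mkcond [X in (_ <= X + _)%N]big_mkcond [X in (_ <= _ + X)%N]big_mkcond -big_split.
  apply: leq_sum => T _ /=; case: ifP => // v'T.
  have [v0|/negbTE nv0] := boolP (v T == 0); first by rewrite bigger //= addn0.
  have [E0|_] := eqVneq T M; first by rewrite E0 v'M eqxx in v'T.
  exact: leq_addl.
(* Every new tree is heavier than [M], so [B] times its term is at most the term of [M]; as [B]
   exceeds the number of graphs, all new terms together stay below the one removed. *)
rewrite ltn_add2r -(@ltn_pmul2l B) // big_distrr /=.
apply: (@leq_ltn_trans (\sum_(T : graph n | (weight M < weight T)%N) w M)%N).
  apply: leq_sum => T lt; rewrite /w -expnS leq_exp2l //; last first.
    by rewrite /B ltnS; apply/card_gt0P; exists M.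
  by have := weight_max T; lia.
rewrite sum_nat_const ltn_mul2r expn_gt0 /= ltnS.
exact: max_card.
Qed.

Lemma step_wf : well_founded (fun v' v : graph n -> rat =>
  (forall T, v T != 0 -> nctree T && (T \subset G)) /\ step G v v').
Proof.
apply: (well_founded_lt_compat _ potential) => v' v [_ /step_potential].
by move/ssrnat.ltP.
Qed.

Lemma normal_form v : supported v -> exists v',
  clos_refl_trans _ (step G) v v' /\ (forall v'', ~ step G v' v'').
Proof.
elim/(well_founded_ind step_wf): v => v IH vs.
have [[v1 v01]|no] := classic (exists v1, step G v v1); last first.
  by exists v; split; [exact: rt_refl|move=> v1 v01; apply: no; exists v1].
have [v2 [v12 nf]] := IH v1 (conj vs v01) (step_supported vs v01).
exists v2; split=> //; exact: rt_trans (rt_step _ _ _ _ v01) v12.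
Qed.

Lemma normal_reduced v : supported v -> (forall v', ~ step G v v') ->
  forall T, v T != 0 -> G_reduced G T.
Proof.
move=> vs nf T vT; apply: NNPP => nr; have /andP[ncT sub] := vs T vT.
have [H [a [s [cd E]]]] := step_exists n0 ncT sub nr.
apply: (nf (fun S => v S - v (Tj H a s (size s)) * rho H a s S)).
by exists H, a, s; rewrite E; split.
Qed.

Lemma reduced_unique c d : (forall T, c T != 0 -> G_reduced G T) ->
  (forall T, d T != 0 -> G_reduced G T) -> congr (comb c) (comb d) ->
  forall T, c T = d T.
Proof.
move=> cr dr /congr_combE I T; apply/eqP; rewrite -subr_eq0; apply/eqP.
apply: (@G_reduced_independent (fun T => c T - d T)) => [S|]; last exact/congr_comb0.
have [E|/cr //] := eqVneq (c S) 0; rewrite E sub0r oppr_eq0; exact: dr.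
Qed.

(** The long cycle has one cycle, so simplicity reads $n-d=1$. *)
Lemma simple_size (w : word n) : simple_mono G (sigma_long n) w ->
  [/\ all (in_graph G) w, sigmaP w = sigma_long n & size w = n.-1].
Proof.
move=> /andP[/andP[wG ws] /eqP wE]; split=> //.
by move: ws; rewrite /simple wE card_porbits_long // => /eqP; lia.
Qed.

Lemma xT_in_EGs T : nctree T -> T \subset G -> inEGs G (sigma_long n) (xT T).
Proof.
move=> ncT sub; exists (xT T); split; last exact: congr_refl.
move=> p; rewrite inE => /eqP -> /=; have [pe oks] := xwordP n0 ncT.
have /andP[tT _] := ncT; have [E sz] := ewt_order tT pe oks.
rewrite /simple_mono /simple -/(gw (xword T)) sigmaP_gw E eqxx andbT.
rewrite card_porbits_long // size_map sz; apply/andP; split; last by apply/eqP; lia.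
apply/allP => _ /mapP[e eT ->]; apply/exists_inP; exists e; last by rewrite eqxx.
by apply: (subsetP sub); rewrite -mem_enum -(perm_mem pe).
Qed.

Lemma EGs_span f : inEGs G (sigma_long n) f ->
  exists c, supported c /\ congr f (comb c).
Proof.
move=> [g [gs fg]]; suff [c [cs gc]] : exists c, supported c /\ congr g (comb c).
  by exists c; split=> //; exact: congr_trans fg gc.
elim: g gs {fg} => [|[k w] g IH] gs.
  exists (fun=> 0); split=> [T|]; first by rewrite eqxx.
  apply/congr_sym/congr_comb0; apply: ideal_ext (ideal0 n) => w.
  by rewrite big1 // => T _; rewrite mul0r.
have [|c [cs /congrE gc]] := IH; first by move=> p pg; apply: gs; rewrite inE pg orbT.
have [wG wE wsz] := simple_size (gs (k, w) (mem_head _ _)).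
have [l [T [ncT sub W]]] := weq_simple n0 wG wE wsz.
exists (fun S => c S + k * l * (S == T)%:R); split=> [S|].
  have [->|_] := eqVneq S T; first by rewrite ncT.
  by rewrite mulr0 addr0; exact: cs.
apply/congrE; apply: ideal_ext (idealD gc (idealZ k W)) => x.
rewrite -cat1s coeff_cat !coeff_combE [coeff [:: _] x]coeffE big_seq1 /=.
under [in RHS]eq_bigr => S _ do rewrite mulrDl.
have D : \sum_S k * l * (S == T)%:R * (cword S == x)%:R = k * l * (cword T == x)%:R.
  rewrite (bigD1 T) //= eqxx mulr1 big1 ?addr0 // => S /negbTE ->.
  by rewrite mulr0 mul0r.
by rewrite big_split /= D -/(cword T); ring.
Qed.

End Rewriting.

Theorem theorem3p14 (n : nat) (G : graph n) :
  (0 < n)%N ->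
  [/\
   (* (1) every x_T, T G-reduced, lies in E_G^sigma, sigma = (1 2 ... n) *)
   (forall T : graph n, G_reduced G T -> inEGs G (sigma_long n) (xT T)),
   (* (2) the x_T, T G-reduced, span E_G^sigma *)
   (forall f : fsum n, inEGs G (sigma_long n) f ->
      exists c : graph n -> rat,
        (forall T, c T != 0 -> G_reduced G T) /\ congr f (comb c)),
   (* (3) the x_T, T G-reduced, are linearly independent *)
   (forall c : graph n -> rat, (forall T, c T != 0 -> G_reduced G T) ->
      congr (comb c) [::] -> forall T, c T = 0),
   (* (4) the linear relations among the x_T (T a noncrossing tree in G) are
          exactly the linear combinations of the cycle relations *)
   (forall c : graph n -> rat,
      (forall T, c T != 0 -> nctree T && (T \subset G)) ->
      (congr (comb c) [::] <->
       exists s : seq (rat * (graph n * ('I_n * seq 'I_n))),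
         (forall t, t \in s -> cycdata G t.2.1 t.2.2.1 t.2.2.2) /\
         forall T, nctree T && (T \subset G) ->
           c T = \sum_(t <- s) t.1 * rho t.2.1 t.2.2.1 t.2.2.2 T)) &
   (* (5) rewriting terminates, always in the (unique) basis expansion *)
   [/\ well_founded (fun v' v : graph n -> rat =>
          (forall T, v T != 0 -> nctree T && (T \subset G)) /\ step G v v'),
       (forall v : graph n -> rat,
          (forall T, v T != 0 -> nctree T && (T \subset G)) ->
          forall v', clos_refl_trans _ (step G) v v' -> (forall v'', ~ step G v' v'') ->
          (forall T, v' T != 0 -> G_reduced G T) /\ congr (comb v') (comb v)) &
       (forall v : graph n -> rat,
          (forall T, v T != 0 -> nctree T && (T \subset G)) ->
          forall v1 v2,
          clos_refl_trans _ (step G) v v1 -> (forall v'', ~ step G v1 v'') ->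
          clos_refl_trans _ (step G) v v2 -> (forall v'', ~ step G v2 v'') ->
          forall T, v1 T = v2 T)]].
Proof.
move=> n0; split.
- by move=> T [ncT sub _]; exact: xT_in_EGs.
- move=> f /(EGs_span n0)[c [cs fc]]; have [c' [cc' nf]] := normal_form n0 cs.
  have [cs' E] := steps_inv n0 cc' cs; exists c'; split.
    exact: (normal_reduced n0 cs' nf).
  exact: congr_trans fc (congr_sym E).
- by move=> c cr; exact: (G_reduced_independent n0 cr).
- move=> c cs; split=> [c0|[s [sP E]]].
    have [c' [cc' nf]] := normal_form n0 cs; have [cs' cE] := steps_inv n0 cc' cs.
    have c'0 := G_reduced_independent n0 (normal_reduced n0 cs' nf) (congr_trans cE c0).
    have [s [sP sE]] := steps_rho cc'; exists s; split=> // T _.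
    by rewrite sE c'0 add0r.
  (* Off the noncrossing trees of [G] both sides are zero, so the identity holds for all edge sets
     and can be summed against [tree_val]. *)
  have E' T : c T = \sum_(t <- s) t.1 * rho t.2.1 t.2.2.1 t.2.2.2 T.
    have [/E //|nT] := boolP (nctree T && (T \subset G)).
    have [->|/cs] := eqVneq (c T) 0; last by rewrite (negbTE nT).
    rewrite big_seq big1 // => t ts.
    have [->|/(rho_supp (sP t ts))] := eqVneq (rho t.2.1 t.2.2.1 t.2.2.2 T) 0.
      by rewrite mulr0.
    by rewrite (negbTE nT).
  apply/congr_comb0; apply/(comb_ideal_val n0); first exact: supported_nctree cs.
  move=> z zi; under eq_bigr => T _ do rewrite E' mulr_suml.
  rewrite exchange_big /= big_seq big1 // => t ts.
  under eq_bigr => T _ do rewrite -mulrA.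
  by rewrite -mulr_sumr (rho_val zi (sP t ts)) mulr0.
- split; first exact: step_wf.
    move=> v vs v' vv' nf; have [vs' E] := steps_inv n0 vv' vs.
    by split=> //; exact: (normal_reduced n0 vs' nf).
  move=> v vs v1 v2 s1 nf1 s2 nf2; have [vs1 E1] := steps_inv n0 s1 vs.
  have [vs2 E2] := steps_inv n0 s2 vs.
  apply: (reduced_unique n0 (normal_reduced n0 vs1 nf1) (normal_reduced n0 vs2 nf2)).
  exact: congr_trans E1 (congr_sym E2).
Qed.
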